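(* Let $T$ be a string of length $n$ and let $\alpha$ be any one of the following measures of $T$: (1) the size $\gamma$ of a string attractor for $T$; (2) the size $g_{rl}$ of a run-length SLP for $T$; (3) the size $c$ of a collage system for $T$; (4) the number $z$ of phrases of the LZ77 parse of $T$; (5) the size $b$ of a macro scheme for $T$. Then any static data structure using $\mathcal{O}(\alpha\,\mathrm{polylog}\,n)$ space needs $\Omega(\log n/\log\log n)$ time to access one random position of $T$ (i.e., to answer a query returning $T[i]$ for a given $i$).
   Context: A string attractor of $T$ is a set $\Gamma\subseteq\{1,\dots,n\}$ such that every substring $T[i..j]$ has an occurrence $T[i'..j']=T[i..j]$ with $p\in[i',j']$ for some $p\in\Gamma$. An SLP is an acyclic grammar with rules $X\rightarrow AB$, $X\rightarrow a$ generating only $T$; a run-length SLP additionally allows $X\rightarrow A^\ell$; a collage system additionally allows $X\rightarrow K[l..r]$ (substring of the expansion of $K$); sizes are numbers of rules. A macro scheme is a set of directives $T[i..j]\leftarrow T[i'..j']$ or $T[i]\leftarrow c$ from which $T$ can be unambiguously decoded; size is the number of directives. The LZ77 parse (non-overlapping variant) greedily factors $T$ into phrases that are either a first occurrence of a character or the longest prefix of the remaining suffix with an earlier occurrence ending before the phrase. Space is measured in machine words; the lower bound is in the cell-probe sense (as for static data structures in the word RAM). *)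

(* Defs.v *)
From HB Require Import structures.
From mathcomp Require Import all_boot all_order all_algebra.
From mathcomp Require Import reals exp.

Set Implicit Arguments.
Unset Strict Implicit.
Unset Printing Implicit Defensive.

Import Order.TTheory GRing.Theory Num.Theory.

(* Positions are 0-based throughout: a text of length n has positions 'I_n.   *)

(* T[i..j], both ends included. *)
Definition substr (A : Type) (T : seq A) (i j : nat) : seq A :=
  drop i (take j.+1 T).

Definition is_attractor (A : eqType) (n : nat) (T : n.-tuple A)
    (Gamma : {set 'I_n}) : Prop :=
  forall i j : 'I_n, i <= j ->
  exists i' j' p : 'I_n,
    [/\ substr T i' j' = substr T i j, p \in Gamma & i' <= p <= j'].

(* Grammars: nonterminals are the elements of 'I_m, each with exactly one     *)
(* rule, so that the number of rules is m.                                    *)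
Inductive rule (A : Type) (m : nat) : Type :=
| Letter of A                     (* X -> a        *)
| Concat of 'I_m & 'I_m           (* X -> B C      *)
| Power of 'I_m & nat             (* X -> B ^ l    *)
| Slice of 'I_m & nat & nat.      (* X -> K[l..r]  *)

Record grammar (A : Type) := Grammar {
  gsize : nat;
  grule : 'I_gsize -> rule A gsize;
  gstart : 'I_gsize }.

Definition rule_deps (A : Type) (m : nat) (r : rule A m) : seq 'I_m :=
  match r with
  | Letter _ => [::]
  | Concat B C => [:: B; C]
  | Power B _ => [:: B]
  | Slice K _ _ => [:: K]
  end.

Definition is_slice (A : Type) (m : nat) (r : rule A m) : bool :=
  if r is Slice _ _ _ then true else false.

Definition acyclic (A : Type) (G : grammar A) : Prop :=
  forall c : seq 'I_(gsize G),
    c != [::] -> ~~ cycle (fun X Y => Y \in rule_deps (grule X)) c.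

Inductive expands (A : Type) (G : grammar A) :
    'I_(gsize G) -> seq A -> Prop :=
| ExpLetter X a : grule X = Letter _ a -> expands X [:: a]
| ExpConcat X B C s t : grule X = Concat _ B C ->
    expands B s -> expands C t -> expands X (s ++ t)
| ExpPower X B l s : grule X = Power _ B l -> 0 < l ->
    expands B s -> expands X (flatten (nseq l s))
| ExpSlice X K l r s : grule X = Slice _ K l r ->
    expands K s -> l <= r -> r < size s -> expands X (substr s l r).

(* The second condition says that no rule is ill-formed, even a useless one:  *)
(* exponents are positive and slices lie within the expansion they refer to.  *)
Definition is_collage (A : Type) (G : grammar A) (T : seq A) : Prop :=
  [/\ acyclic G,
      forall X, exists s, expands (G := G) X s &
      forall s, expands (gstart G) s <-> s = T].

Definition is_rlslp (A : Type) (G : grammar A) (T : seq A) : Prop :=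
  (forall X : 'I_(gsize G), ~~ is_slice (grule X)) /\ is_collage G T.

(* p is the next phrase of the parse when u has been parsed and v remains.    *)
(* An earlier occurrence ending before the phrase is an occurrence inside u.  *)
Definition is_lz77_phrase (A : eqType) (u v p : seq A) : Prop :=
  prefix p v /\
  ((exists2 c, p = [:: c] & c \notin u) \/
   [/\ p != [::], infix p u &
       forall q, prefix q v -> infix q u -> size q <= size p]).

Definition is_lz77_parse (A : eqType) (ps : seq (seq A)) (T : seq A) : Prop :=
  flatten ps = T /\
  forall k, k < size ps ->
    is_lz77_phrase (flatten (take k ps)) (flatten (drop k ps)) (nth [::] ps k).

(* inl ((i, j), (i', j')) is T[i..j] <- T[i'..j'];  inr (i, c) is T[i] <- c.  *)
Definition directive (A : finType) (n : nat) : finType :=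
  ((('I_n * 'I_n) * ('I_n * 'I_n)) + ('I_n * A))%type.

Definition wf_directive (A : finType) (n : nat) (d : directive A n) : bool :=
  match d with
  | inl (i, j, (i', j')) => [&& i <= j, i' <= j' & j - i == j' - i']
  | inr _ => true
  end.

(* decodes M p c: following the directives of M from position p leads to the  *)
(* letter c. Being inductive, it excludes circular chains of copies.          *)
Inductive decodes (A : finType) (n : nat) (M : {set directive A n}) :
    'I_n -> A -> Prop :=
| DecLetter p c : inr (p, c) \in M -> decodes M p c
| DecCopy (i j i' j' p q : 'I_n) c : inl (i, j, (i', j')) \in M ->
    i <= p <= j -> q = i' + (p - i) :> nat -> decodes M q c -> decodes M p c.

Definition is_macro_scheme (A : finType) (n : nat) (M : {set directive A n})
    (T : n.-tuple A) : Prop :=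
  (forall d, d \in M -> wf_directive d) /\
  (forall p c, decodes M p c <-> c = tnth T p).

Inductive dict_measure : Type :=
| Attractor | RLSLP | Collage | LZ77 | MacroScheme.

Definition representation (m : dict_measure) (A : finType) (n : nat) : Type :=
  match m with
  | Attractor => {set 'I_n}
  | RLSLP => grammar A
  | Collage => grammar A
  | LZ77 => seq (seq A)
  | MacroScheme => {set directive A n}
  end.

Definition is_repr_of (m : dict_measure) (A : finType) (n : nat) (T : n.-tuple A) :
    representation m A n -> Prop :=
  match m return representation m A n -> Prop with
  | Attractor => fun Gamma => is_attractor T Gamma
  | RLSLP => fun G => is_rlslp G T
  | Collage => fun G => is_collage G T
  | LZ77 => fun ps => is_lz77_parse ps T
  | MacroScheme => fun M => is_macro_scheme M T
  end.

Definition repr_size (m : dict_measure) (A : finType) (n : nat) :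
    representation m A n -> nat :=
  match m return representation m A n -> nat with
  | Attractor => fun Gamma => #|Gamma|
  | RLSLP => fun G => gsize G
  | Collage => fun G => gsize G
  | LZ77 => fun ps => size ps
  | MacroScheme => fun M => #|M|
  end.

(* The cell-probe model: an adaptive query algorithm is a decision tree whose *)
(* inner nodes read one w-bit cell; only the probes are charged.              *)
Inductive probe_tree (w : nat) (A : Type) : Type :=
| Answer of A
| Probe of nat & (w.-tuple bool -> probe_tree w A).

(* Cells beyond the end of the memory read as zero. *)
Definition read_cell (w : nat) (mem : seq (w.-tuple bool)) (a : nat) :
    w.-tuple bool :=
  nth (nseq_tuple w false) mem a.

Fixpoint answer (w : nat) (A : Type) (t : probe_tree w A)
    (mem : seq (w.-tuple bool)) : A :=
  match t with
  | Answer x => x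
  | Probe a next => answer (next (read_cell mem a)) mem
  end.

Fixpoint probes (w : nat) (A : Type) (t : probe_tree w A)
    (mem : seq (w.-tuple bool)) : nat :=
  match t with
  | Answer _ => 0
  | Probe a next => (probes (next (read_cell mem a)) mem).+1
  end.

(* A static data structure for random access. The alphabet Sigma n and the    *)
(* word size may depend on the text length n. The memory is built from the    *)
(* text and one of its representations X (whose size is the parameter of the  *)
(* space bound); the query algorithm sees neither, except through probes.     *)
Record access_structure (m : dict_measure) (Sigma : nat -> finType) :=
  AccessStructure {
    word_size : nat -> nat;
    memory : forall n, n.-tuple (Sigma n) -> representation m (Sigma n) n ->
               seq ((word_size n).-tuple bool);
    query : forall n, 'I_n -> probe_tree (word_size n) (Sigma n) }.

Definition solves_access (m : dict_measure) (Sigma : nat -> finType)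
    (D : access_structure m Sigma) : Prop :=
  forall n (T : n.-tuple (Sigma n)) (X : representation m (Sigma n) n) (i : 'I_n),
    is_repr_of T X -> answer (query D i) (memory D T X) = tnth T i.

Local Open Scope ring_scope.

Definition log2 (R : realType) (x : R) : R := ln x / ln 2.

(* w = O(log n) *)
Definition log_word_size (R : realType) (m : dict_measure) (Sigma : nat -> finType)
    (D : access_structure m Sigma) : Prop :=
  exists (C : R) (N : nat), forall n, (N <= n)%N ->
    (word_size D n)%:R <= C * log2 n%:R.

(* O(alpha polylog n) words, alpha being the size of the representation *)
Definition polylog_space (R : realType) (m : dict_measure) (Sigma : nat -> finType)
    (D : access_structure m Sigma) : Prop :=
  exists (C : R) (k N : nat), forall n, (N <= n)%N ->
    forall (T : n.-tuple (Sigma n)) (X : representation m (Sigma n) n),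
      is_repr_of T X ->
      (size (memory D T X))%:R <= C * (repr_size X)%:R * log2 n%:R ^+ k.

(* Main.v *)
(* The hard texts list, for all pairs (s, t) of a source and a sink of a       *)
(* butterfly of degree b and depth d, the parity of a labelling x of its edges *)
(* along the path from s to t. Such a text is a straight-line program in which *)
(* every node is a concatenation of b nodes of the next level, so all measures *)
(* are O(d b^(d+1) + log n), although it encodes d b^(d+1) independent bits.   *)
(*   Let every query make at most t probes. Putting a permutation at each      *)
(* switch routes all sources to distinct sinks, in (b!)^(d b^(d-1)) ways, and  *)
(* the b^d queries of a routing probe at most m = b^d t cells. The space being *)
(* m polylog n, there are 2^O(m log log n) sets of m cells; so one of them     *)
(* serves a 2^-O(m log log n) fraction of all routings, and by AM-GM the       *)
(* queries it answers cover at least d b^(d+1) / 2^O((t / d) log log n) edges. *)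
(* A path through an edge not seen before adds one bit of information, whereas *)
(* these cells hold only m w bits. With b = polylog n this is contradictory    *)
(* unless t log log n = Omega(d log b) = Omega(log n).                         *)

Require Import Defs.
From mathcomp Require Import all_boot all_order all_algebra all_fingroup.
From mathcomp Require Import reals exp zify.

Set Implicit Arguments.
Unset Strict Implicit.
Unset Printing Implicit Defensive.

(** * From straight-line programs to the five measures *)

(** Butterfly texts are repetitive under all five measures, yet their letters are parities of many
    independent bits, spread so that few probes cannot serve all queries.

    Repetitiveness goes through one notion, a chain of words in which each is a letter or the
    concatenation of two earlier ones. [repr_of_chain] turns a chain of [g] words into a
    representation of size at most [g + 1] for any of the measures, and [butterfly_text_chainable]
    supplies short chains for the texts.

    On the probe side, [butterfly_certificate] fixes by pigeonhole a small cell set [C] and its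
    contents, compatible with many labellings, such that [C] serves many routings. The queries
    answered within [C] have the same answers for all these labellings; let [U] be the set of edges
    on their paths. By [parity_rank], at least [|U| / d] of the answers are independent, so [|U|] is
    at most [d] times the number of bits spent on choosing [C] and its contents. By
    [card_routing_in], the routings served by [C] number at most the product of the out-degrees in
    [U], which [nat_AGM] bounds in terms of [|U|].

    Comparing this with the number of all routings gives [butterfly_lower_bound]. Finally
    [access_lower_bound_nat] takes a polylogarithmic degree and a depth of order log n / log log
    n. *)

Definition word_chain (A : eqType) (ps : seq (seq A)) : Prop :=
  forall k, k < size ps ->
  (exists c, nth [::] ps k = [:: c]) \/
  (exists i j, [/\ i < k, j < k &
     nth [::] ps k = nth [::] ps i ++ nth [::] ps j]).

(** One chain serves all of [V], so that subwords shared by its members are paid for once. *)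
Definition chainable (A : eqType) (g : nat) (V : seq (seq A)) : Prop :=
  exists ps, [/\ word_chain ps, size ps <= g & {subset V <= ps}].

Lemma chainable_sub (A : eqType) g g' (V V' : seq (seq A)) :
  chainable g V -> g <= g' -> {subset V' <= V} -> chainable g' V'.
Proof.
move=> [ps [chP szP subP]] le_gg' subV; exists ps; split=> //.
  exact: leq_trans le_gg'.
by move=> w /subV/subP.
Qed.

Lemma chainable_cat (A : eqType) g (V : seq (seq A)) u v :
  chainable g V -> u \in V -> v \in V -> chainable g.+1 ((u ++ v) :: V).
Proof.
move=> [ps [chP szP subP]] /subP u_ps /subP v_ps.
exists (rcons ps (u ++ v)); split; last first.
- by move=> w; rewrite inE mem_rcons inE => /orP[->//|/subP ->]; rewrite orbT.
- by rewrite size_rcons.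
move=> k; rewrite size_rcons ltnS leq_eqVlt => /orP[/eqP ->|lt_k].
  right; exists (index u ps), (index v ps); rewrite !index_mem; split=> //.
  by rewrite !nth_rcons ltnn eqxx !index_mem u_ps v_ps !nth_index.
rewrite nth_rcons lt_k; case: (chP k lt_k) => [|[i [j [lt_i lt_j def_k]]]].
  by left.
right; exists i, j; split=> //.
by rewrite !nth_rcons (ltn_trans lt_i lt_k) (ltn_trans lt_j lt_k).
Qed.

(** Each piece costs one more word, prepended to the suffix already built. [us] must be nonempty
    because a chain never contains the empty word. *)
Lemma chainable_flatten (A : eqType) g (V us : seq (seq A)) :
  chainable g V -> us != [::] -> {subset us <= V} ->
  chainable (g + size us) (flatten us :: V).
Proof.
move=> chV; elim: us => // u us IH _ subV.
have uV : u \in V by apply: subV; rewrite mem_head.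
have subV' : {subset us <= V} by move=> w w_us; apply: subV; rewrite inE w_us orbT.
have [->|us_n0] := eqVneq us [::].
  rewrite /= cats0; apply: (chainable_sub chV); first exact: leq_addr.
  by move=> w; rewrite inE => /orP[/eqP->|].
have := chainable_cat (IH us_n0 subV') (u := u) (v := flatten us).
rewrite !inE eqxx uV orbT -addnS => /(_ isT isT) ch.
apply: (chainable_sub ch) => // w; rewrite !inE => /orP[->//|->].
by rewrite !orbT.
Qed.

Lemma chainable_flattens (A : eqType) g b (V ws : seq (seq A)) :
  chainable g V ->
  (forall w, w \in ws -> exists us,
     [/\ us != [::], size us <= b, {subset us <= V} & w = flatten us]) ->
  chainable (g + b * size ws) (ws ++ V).
Proof.
move=> chV; elim: ws => [|w ws IH] dec; first by rewrite muln0 addn0.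
have [us [us_n0 sz_us subV def_w]] := dec w (mem_head _ _).
have IHw := IH (fun w' w'_ws => dec w' (mem_behead (s := w :: ws) w'_ws)).
have := chainable_flatten IHw us_n0.
case=> [v /subV v_V|ps [chP szP subP]]; first by rewrite mem_cat v_V orbT.
exists ps; split=> //; last by rewrite def_w.
by apply: (leq_trans szP); rewrite mulnS /= -addnA leq_add2l addnC leq_add2r.
Qed.

(** Repeated doubling: each binary digit of [k] costs at most two words, one to double and one to
    add [a]. *)
Lemma chainable_nseq (A : eqType) g (V : seq (seq A)) a e k :
  chainable g V -> [:: a] \in V -> 0 < k -> k < 2 ^ e ->
  chainable (g + e.*2) (nseq k a :: V).
Proof.
move=> chV aV; elim: e k => [|e IH] k k_gt0 lt_k.
  by move: lt_k; rewrite expn0 ltnS leqn0; case: k k_gt0.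
have [k1|k_neq1] := eqVneq k 1.
  apply: (chainable_sub chV); first exact: leq_addr.
  by move=> w; rewrite inE k1 => /orP[/eqP->|].
have k2_gt0 : 0 < k./2 by lia.
have k2_lt : k./2 < 2 ^ e by move: lt_k; rewrite expnS; lia.
have ch1 := IH _ k2_gt0 k2_lt.
have := chainable_cat ch1 (mem_head _ _) (mem_head _ _).
rewrite -nseqD addnn => ch2.
have := chainable_cat ch2 (u := [:: a]) (v := nseq k./2.*2 a).
rewrite !inE eqxx aV !orbT => /(_ isT isT) ch3.
rewrite doubleS !addnS; case odd_k : (odd k); [move: ch3 | move: ch2] => ch.
- apply: (chainable_sub ch) => // w; rewrite !inE => /orP[/eqP->|->].
    by rewrite -[in nseq k a](odd_double_half k) odd_k /= eqxx.
  by rewrite !orbT.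
apply: (chainable_sub ch) => // w; rewrite !inE => /orP[/eqP->|->].
  by rewrite -[in nseq k a](odd_double_half k) odd_k /= eqxx.
by rewrite !orbT.
Qed.

Lemma word_chain_neq0 (A : eqType) (ps : seq (seq A)) k :
  word_chain ps -> k < size ps -> nth [::] ps k != [::].
Proof.
move=> chP; elim/ltn_ind: k => k IH lt_k.
case: (chP k lt_k) => [[c ->//]|[i [j [lt_i lt_j ->]]]].
by have := IH i lt_i (ltn_trans lt_i lt_k); case: (nth _ _ _).
Qed.

(** The chain is the grammar: its indices are the nonterminals and its words their expansions.
    Dependencies go to smaller indices, which excludes cycles. *)
Lemma rlslp_of_chain (A : eqType) (ps : seq (seq A)) T :
  word_chain ps -> T \in ps ->
  exists G : grammar A, is_rlslp G T /\ gsize G = size ps.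
Proof.
move=> chP T_ps; set g := size ps.
pose P (k : 'I_g) (r : rule A g) := match r with
  | Letter c => nth [::] ps k = [:: c]
  | Concat i j => [/\ i < k, j < k &
      nth [::] ps k = nth [::] ps i ++ nth [::] ps j]
  | _ => False end.
have /fin_all_exists[f fP] : forall k, exists r, P k r.
  move=> k; case: (chP k (ltn_ord k)) => [[c def_k]|[i [j [lt_i lt_j def_k]]]].
    by exists (Letter _ c).
  exists (Concat _ (Ordinal (ltn_trans lt_i (ltn_ord k)))
                   (Ordinal (ltn_trans lt_j (ltn_ord k)))); split=> //.
have lt_T : index T ps < g by rewrite index_mem.
pose G := @Grammar A g f (Ordinal lt_T).
have dep_lt (X Y : 'I_g) : Y \in rule_deps (f X) -> Y < X.
  by have := fP X; case: (f X) => //= B C [? ? _];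
    rewrite !inE => /orP[] /eqP->.
have exp_unique (X : 'I_(gsize G)) s : expands X s -> s = nth [::] ps X.
  elim=> {X s} [X a|X B C s t|X B l s|X K l r s] /= def_X.
  - by have := fP X; rewrite def_X.
  - by move=> _ -> _ ->; have := fP X; rewrite def_X => -[].
  - by have := fP X; rewrite def_X.
  - by have := fP X; rewrite def_X.
have exp_exists (X : 'I_(gsize G)) : expands X (nth [::] ps X).
  have [n] := ubnP (X : nat); elim: n X => // n IH X; rewrite ltnS => le_X.
  have := fP X; case def_X: (f X) => [a|B C|B l|K l r] //=.
    by move=> ->; apply: ExpLetter.
  move=> [lt_B lt_C ->]; apply: (ExpConcat (G := G) def_X); apply: IH;
    exact: leq_trans le_X.
exists G; split=> //; split.
  by move=> X; have := fP X => /=; case: (f X).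
split.
- case=> // X c _; apply/negP => /= cyc.
  have tr : transitive (fun Y Z : 'I_g => Z < Y).
    by move=> Y Z U /= lt1 lt2; exact: ltn_trans lt2 lt1.
  have : path (fun Y Z : 'I_g => Z < Y) X (rcons c X).
    by apply: sub_path cyc => Y Z /=; exact: dep_lt.
  by move/(order_path_min tr); rewrite all_rcons /= ltnn.
- by move=> X; exists (nth [::] ps X).
move=> s; split=> [/exp_unique|] ->; first by rewrite /= nth_index.
by have := exp_exists (gstart G); rewrite /= nth_index.
Qed.

(** An LZ77 factorization without greediness: a phrase is any single letter, or a word occurring in
    the text before it. *)
Fixpoint lz_like (A : eqType) (u : seq A) (fs : seq (seq A)) : bool :=
  if fs is p :: fs' then
    [&& p != [::], (size p == 1) || infix p u & lz_like (u ++ p) fs']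
  else true.

Lemma lz_like_cat (A : eqType) (u : seq A) fs fs' :
  lz_like u (fs ++ fs') = lz_like u fs && lz_like (u ++ flatten fs) fs'.
Proof.
by elim: fs u => [|p fs IH] u /=; rewrite ?cats0 // IH catA !andbA.
Qed.

(* Visiting the parse tree and cutting at every word visited before creates   *)
(* at most one more phrase than it visits new words.                          *)
Lemma lz_like_visit (A : eqType) (ps : seq (seq A)) (k : 'I_(size ps)) u
    (V : {set 'I_(size ps)}) :
  word_chain ps -> (forall j, j \in V -> infix (nth [::] ps j) u) ->
  exists fs (V' : {set 'I_(size ps)}),
    [/\ lz_like u fs, flatten fs = nth [::] ps k, V \subset V',
        k \in V' & size fs + #|V| <= #|V'|.+1] /\
    (forall j, j \in V' -> infix (nth [::] ps j) (u ++ nth [::] ps k)) /\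
    (forall j, j \in V' -> j \in V \/ j <= k).
Proof.
move=> chP; have [n] := ubnP (k : nat).
elim: n k u V => // n IH k u V; rewrite ltnS => le_k V_u.
have nz_k := word_chain_neq0 chP (ltn_ord k).
have [kV|kNV] := boolP (k \in V).
  exists [:: nth [::] ps k], V; split; last split.
  - by split=> //=; rewrite ?cats0 ?nz_k ?V_u ?orbT //.
  - by move=> j /V_u/infix_catr.
  - by move=> j; left.
case: (chP k (ltn_ord k)) => [[c def_k]|[i [j [lt_i lt_j def_k]]]].
  exists [:: [:: c]], (k |: V); split; last split.
  - by split; rewrite ?subsetU1 ?setU11 ?def_k ?cardsU1 ?kNV.
  - move=> j; rewrite !inE => /orP[/eqP->|/V_u/infix_catr] //.
    exact: suffix_infix.
  - by move=> j; rewrite !inE => /orP[/eqP->|]; [right|left].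
pose i' := Ordinal (ltn_trans lt_i (ltn_ord k)).
pose j' := Ordinal (ltn_trans lt_j (ltn_ord k)).
have [f1 [V1 [[lz1 fl1 sub1 in1 card1] [inf1 new1]]]] :=
  IH i' u V (leq_trans lt_i le_k) V_u.
have [f2 [V2 [[lz2 fl2 sub2 in2 card2] [inf2 new2]]]] :=
  IH j' _ V1 (leq_trans lt_j le_k) inf1.
(* The parts of word [k] visit only smaller indices, so [k] is new and pays for the extra phrase
   that a second visit may create. *)
have kNV2 : k \notin V2.
  apply/negP => /new2[/new1[]|] /=; first by rewrite (negPf kNV).
    by rewrite leqNgt lt_i.
  by rewrite leqNgt lt_j.
exists (f1 ++ f2), (k |: V2); split; last split.
- split.
  + by rewrite lz_like_cat lz1 fl1.
  + by rewrite flatten_cat fl1 fl2 def_k.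
  + by apply: subset_trans (subsetU1 _ _); exact: subset_trans sub2.
  + exact: setU11.
  + by rewrite size_cat cardsU1 kNV2; lia.
- move=> l; rewrite !inE => /orP[/eqP->|/inf2].
    exact: suffix_infix.
  by rewrite -catA -def_k.
- move=> l; rewrite !inE => /orP[/eqP->|/new2[/new1[]|]]; [by right|by left|..].
  + by right; rewrite (leq_trans _ (ltnW lt_i)).
  + by right; rewrite (leq_trans _ (ltnW lt_j)).
Qed.

Lemma lz_like_of_chain (A : eqType) (ps : seq (seq A)) T :
  word_chain ps -> T \in ps ->
  exists fs, [/\ lz_like [::] fs, flatten fs = T & size fs <= (size ps).+1].
Proof.
move=> chP T_ps; have lt_T : index T ps < size ps by rewrite index_mem.
have [|fs [V [[lz fl _ _]]]] :=
  @lz_like_visit _ ps (Ordinal lt_T) [::] set0 chP.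
  by move=> j; rewrite inE.
rewrite cards0 addn0 => card_V _; exists fs; split=> //.
  by rewrite fl /= nth_index.
apply: (leq_trans card_V); rewrite ltnS -[leqRHS]card_ord; exact: max_card.
Qed.

Lemma eq_cat_split (A : Type) (s1 s2 t1 t2 : seq A) :
  s1 ++ t1 = s2 ++ t2 -> size s1 <= size s2 ->
  exists2 b, s2 = s1 ++ b & t1 = b ++ t2.
Proof.
elim: s1 s2 => [|x s1 IH] [|y s2] //= => [e _|e _|[-> e]].
- by exists [::].
- by exists (y :: s2).
- by rewrite ltnS => /(IH _ e)[b -> ->]; exists b.
Qed.

(** The phrase is a fresh letter or the longest prefix found in [u]. The last clause holds in both
    cases and is the form in which greediness is used. *)
Lemma lz77_phrase_exists (A : eqType) (u v : seq A) : v != [::] ->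
  exists q, [/\ is_lz77_phrase u v q, q != [::] &
    forall b, prefix b v -> infix b u -> size b <= size q].
Proof.
case: v => // c v _; have [cu|cNu] := boolP (c \in u); last first.
  exists [:: c]; split=> //.
    by split; [rewrite /= eqxx prefix0s | left; exists c].
  move=> [|c' b] //= /andP[/eqP-> _] /mem_infix/(_ c).
  by rewrite mem_head (negPf cNu) => /(_ isT).
pose P l := infix (take l (c :: v)) u && (l <= (size v).+1).
have P1 : P 1 by rewrite /P /= take0 infix1s cu.
have Pbnd l : P l -> l <= (size v).+1 by case/andP.
have [l /andP[inf_l le_l] max_l] := ex_maxnP (ex_intro P 1 P1) Pbnd.
have sz_l : size (take l (c :: v)) = l by rewrite size_takel.
have l_gt0 : 0 < l by exact: max_l.
have q_n0 : take l (c :: v) != [::] by case: (l) l_gt0.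
have max_q b : prefix b (c :: v) -> infix b u -> size b <= l.
  move=> pre_b inf_b; have sz_b := size_prefix pre_b.
  move: pre_b; rewrite prefixE => /eqP def_b.
  by apply: max_l; rewrite /P def_b inf_b.
exists (take l (c :: v)); split=> //; last by rewrite sz_l.
by split; [exact: prefix_take | right; split=> //; rewrite sz_l].
Qed.

(* The greedy parse never falls behind another factorization: a phrase that   *)
(* straddles the current position leaves a suffix that can still be copied.   *)
Lemma lz77_greedy (A : eqType) (fs : seq (seq A)) u' u v :
  lz_like u' fs -> prefix u' u -> u ++ v = u' ++ flatten fs ->
  exists ps, [/\ size ps <= size fs, flatten ps = v &
    forall k, k < size ps ->
      is_lz77_phrase (u ++ flatten (take k ps)) (flatten (drop k ps))
        (nth [::] ps k)].
Proof.
elim: fs u' u v => [|p fs IH] u' u v /=.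
  move=> _ /prefixP[a ->] /(congr1 size); rewrite !size_cat /= => sz.
  by exists [::]; split=> //=; case: v sz => //= *; lia.
move=> /and3P[p_n0 p_src lz_fs] /prefixP[a ->]; rewrite -catA => /eqP.
rewrite eqseq_cat // eqxx /= => /eqP e_av.
(* [a] is the lead of the greedy parse: a phrase [p] within it is skipped at no cost; otherwise [b]
   is the part of [p] beyond it. *)
have [le_pa|lt_ap] := leqP (size p) (size a).
  have [b def_a def_F] := eq_cat_split (esym e_av) le_pa.
  have [||ps [sz_ps fl_ps ph_ps]] := IH (u' ++ p) (u' ++ a) v lz_fs.
  - by rewrite def_a catA prefix_prefix.
  - by rewrite -!catA e_av.
  by exists ps; split=> //; exact: leqW.
have [b def_p def_v] := eq_cat_split e_av (ltnW lt_ap).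
have b_n0 : 0 < size b by rewrite def_p size_cat in lt_ap; lia.
have v_n0 : v != [::] by rewrite def_v; case: (b) b_n0.
have [q [ph_q q_n0 max_q]] := lz77_phrase_exists (u' ++ a) v_n0.
have le_bq : size b <= size q.
  case/orP: p_src => [/eqP p1|inf_p].
    rewrite def_p size_cat in p1; case: (q) q_n0 => //= *; lia.
  apply: max_q; first by rewrite def_v prefix_prefix.
  by apply: infix_catr; apply: (@catl_infix _ a); rewrite -def_p.
have /prefixP[v' def_v'] : prefix q v by case: ph_q.
have [r def_q _] : exists2 r, q = b ++ r & flatten fs = r ++ v'.
  by apply: eq_cat_split le_bq; rewrite -def_v.
have [||ps [sz_ps fl_ps ph_ps]] := IH (u' ++ p) (u' ++ a ++ q) v' lz_fs.
- by rewrite def_q def_p !catA -[_ ++ r]catA -!catA !catA prefix_prefix.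
- by rewrite -!catA -def_v' e_av.
exists (q :: ps); split=> //=; first by rewrite fl_ps def_v'.
case=> [_|k]; first by rewrite cats0 /= fl_ps -def_v'.
by rewrite ltnS => /ph_ps; rewrite /= -!catA.
Qed.

Lemma lz77_of_lz_like (A : eqType) (fs : seq (seq A)) T :
  lz_like [::] fs -> flatten fs = T ->
  exists ps, is_lz77_parse ps T /\ size ps <= size fs.
Proof.
move=> lz def_T; have [//|//|ps [sz fl ph]] := @lz77_greedy _ fs [::] [::] T lz.
by exists ps.
Qed.

Definition dir_start (A : finType) n (d : directive A n) : 'I_n :=
  match d with inl (i, _, _) => i | inr (p, _) => p end.

Definition dir_end (A : finType) n (d : directive A n) : 'I_n :=
  match d with inl (_, j, _) => j | inr (p, _) => p end.

(** Sources end strictly before their targets begin, so induction on text positions is possible. *)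
Definition left_directive (A : finType) n (T : n.-tuple A)
    (d : directive A n) : Prop :=
  match d with
  | inl (i, j, (i', j')) =>
      [/\ i <= j, j' < i, i' + (j - i) = j' :> nat &
          forall p q : 'I_n, i <= p <= j -> q = i' + (p - i) :> nat ->
            tnth T p = tnth T q]
  | inr (p, c) => c = tnth T p
  end.

Lemma left_scheme_of_lz_like (A : finType) n (T : n.-tuple A)
    (fs : seq (seq A)) (u : seq A) :
  lz_like u fs -> u ++ flatten fs = T ->
  exists M : {set directive A n},
    [/\ forall d, d \in M -> left_directive T d,
        forall p : 'I_n, size u <= p ->
          exists2 d, d \in M & dir_start d <= p <= dir_end d &
        #|M| <= size fs].
Proof.
elim: fs u => [|p fs IH] u /=.
  move=> _; rewrite cats0 => def_T; exists set0; split.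
  - by move=> d; rewrite inE.
  - by move=> q; have := ltn_ord q; rewrite def_T size_tuple; lia.
  - by rewrite cards0.
move=> /and3P[p_n0 p_src lz_fs] def_T.
have [|M [goodM covM cardM]] := IH _ lz_fs; first by rewrite -catA.
have szT : size u + size p + size (flatten fs) = n.
  by rewrite -(size_tuple T) -def_T !size_cat addnA.
have p_gt0 : 0 < size p by case: (p) p_n0.
have lt_a : size u < n by lia.
have lt_e : size u + (size p).-1 < n by lia.
suff [d [good_d st_d en_d]] : exists d : directive A n,
    [/\ left_directive T d, dir_start d = size u :> nat &
        dir_end d = size u + (size p).-1 :> nat].
  exists (d |: M); split.
  - by move=> d'; rewrite !inE => /orP[/eqP->|/goodM].
  - move=> q le_q; have [lt_q|ge_q] := ltnP q (size (u ++ p)); last first.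
      by have [d' d'M cov] := covM q ge_q; exists d'; rewrite // !inE d'M orbT.
    exists d; first exact: setU11.
    by rewrite st_d en_d le_q /= -ltnS -addnS prednK // -size_cat.
  - by rewrite cardsU1; exact: (leq_add (leq_b1 _) cardM).
case/orP: p_src => [/eqP p1|inf_p].
  case: p p1 p_n0 p_gt0 def_T {lz_fs goodM covM cardM szT lt_e} => // c [] //.
  move=> _ _ _ def_T; exists (inr (Ordinal lt_a, c)); split=> //=; last lia.
  by rewrite (tnth_nth c) /= -def_T nth_cat ltnn subnn.
have [s [s' def_u]] : exists s s' : seq A, u = s ++ p ++ s' by exact/infixP.
have szu : size u = size s + size p + size s'.
  by rewrite def_u !size_cat addnA.
have lt_i : size s < n by lia.
have lt_j : size s + (size p).-1 < n by lia.
exists (inl (Ordinal lt_a, Ordinal lt_e, (Ordinal lt_i, Ordinal lt_j))).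
split=> //=; split=> /=; [lia|lia|lia|].
move=> x y /= xb def_y; have z := tnth T x; rewrite !(tnth_nth z).
rewrite -def_T nth_cat ifF; last lia.
rewrite [RHS]nth_cat ifT; last lia.
rewrite nth_cat ifT; last lia.
rewrite [in RHS]def_u [RHS]nth_cat ifF; last lia.
rewrite [RHS]nth_cat ifT; last lia.
by congr (nth _ _ _); lia.
Qed.

Lemma macro_scheme_of_left (A : finType) n (T : n.-tuple A)
    (M : {set directive A n}) :
  (forall d, d \in M -> left_directive T d) ->
  (forall p : 'I_n, exists2 d, d \in M & dir_start d <= p <= dir_end d) ->
  is_macro_scheme M T.
Proof.
move=> goodM covM; split.
  move=> [[[i j] [i' j']]|[p c]] // /goodM /= [le_ij _ def_j' _].
  by apply/and3P; split=> //; apply/eqP; lia.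
move=> p c; split.
  elim=> {p c} [p c /goodM //|i j i' j' p q c /goodM /= [_ _ _ eqT]].
  by move=> p_ij def_q _ ->; rewrite (eqT p q).
move=> {c}->; have [k] := ubnP (p : nat); elim: k p => // k IH p; rewrite ltnS => le_p.
have [[[[i j] [i' j']]|[q c]] dM] := covM p.
  move=> /= p_ij; have [le_ij lt_j' def_j' eqT] := goodM _ dM.
  have lt_q : i' + (p - i) < n by have := ltn_ord j'; lia.
  rewrite (eqT p (Ordinal lt_q)) //.
  by apply: (DecCopy dM p_ij (q := Ordinal lt_q)) => //; apply: IH => /=; lia.
move=> /= p_q; have -> : p = q by apply/val_inj => /=; lia.
by apply: DecLetter; rewrite -(goodM _ dM).
Qed.

(** An interval starting within a target either reaches the end of that target, or lies inside it
    and is copied with it to the left, where induction on the starting position applies. *)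
Lemma attractor_of_left (A : finType) n (T : n.-tuple A)
    (M : {set directive A n}) :
  (forall d, d \in M -> left_directive T d) ->
  (forall p : 'I_n, exists2 d, d \in M & dir_start d <= p <= dir_end d) ->
  is_attractor T [set dir_end d | d in M].
Proof.
move=> goodM covM i; have [k] := ubnP (i : nat).
elim: k i => // k IH i; rewrite ltnS => le_i j le_ij.
have [d dM] := covM i; have [end_d|] := leqP (dir_end d) j.
  move=> /andP[_ i_end]; exists i, j, (dir_end d); split=> //.
    exact: imset_f.
  by rewrite i_end.
case: d dM => [[[a b] [a' b']]|[q c]] /= dM lt_b; last by lia.
move=> a_i; have [le_ab lt_b' def_b' eqT] := goodM _ dM.
have lt_x : a' + (i - a) < n by have := ltn_ord b'; lia.
have lt_y : a' + (j - a) < n by have := ltn_ord b'; lia.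
have [||i' [j' [p [sub_eq pG p_in]]]] := IH (Ordinal lt_x) _ (Ordinal lt_y).
- by move=> /=; lia.
- by move=> /=; lia.
exists i', j', p; split=> //; rewrite sub_eq /substr /=.
have szT := size_tuple T; have := ltn_ord i; have := ltn_ord j => lt_j lt_i.
have x0 := tnth T i; apply: (@eq_from_nth _ x0).
  by rewrite !size_drop !size_take_min szT; lia.
move=> l; rewrite size_drop size_take_min szT => lt_l.
rewrite !nth_drop !nth_take; [|lia|lia].
have lt_p : i + l < n by lia.
have lt_q : a' + (i - a) + l < n by lia.
have := eqT (Ordinal lt_p) (Ordinal lt_q); rewrite !(tnth_nth x0) /=.
by move=> -> //; lia.
Qed.

Lemma repr_of_chain (m : dict_measure) (A : finType) n (T : n.-tuple A) g :
  chainable g [:: tval T] ->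
  exists X : representation m A n, is_repr_of T X /\ repr_size X <= g.+1.
Proof.
move=> [ps [chP szP subP]]; have T_ps : tval T \in ps by rewrite subP ?mem_head.
have [G [G_T szG]] := rlslp_of_chain chP T_ps.
have [fs [lz_fs def_T sz_fs]] := lz_like_of_chain chP T_ps.
have le_fs : size fs <= g.+1 by exact: leq_trans sz_fs _.
have [M [goodM covM cardM]] := left_scheme_of_lz_like (T := T) lz_fs def_T.
have le_M := leq_trans cardM le_fs.
case: m => /=.
- exists [set dir_end d | d in M]; split; last exact: leq_trans (leq_imset_card _ _) _.
  by apply: attractor_of_left => // p; exact: covM.
- by exists G; rewrite szG leqW.
- by exists G; rewrite szG leqW //; case: G_T.
- have [zs [zs_T sz_zs]] := lz77_of_lz_like lz_fs def_T.
  by exists zs; split=> //; exact: leq_trans sz_zs _.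
- by exists M; split=> //; apply: macro_scheme_of_left => // p; exact: covM.
Qed.

(** * Counting *)

(** Bernoulli's inequality [(1 - 1/(a+1))^j >= 1 - j/(a+1)], cleared of denominators. *)
Lemma leq_expn_succ a j : j <= a -> a.+1 ^ j * (a.+1 - j) <= a ^ j * a.+1.
Proof.
elim: j => [|j IH] lt_ja; first by rewrite subn0.
have IHj := IH (ltnW lt_ja).
have step : a.+1 * (a.+1 - j.+1) <= a * (a.+1 - j) by nia.
rewrite expnSr -mulnA (leq_trans (leq_mul (leqnn _) step)) //.
by rewrite mulnCA expnS -mulnA leq_mul.
Qed.

Lemma leq_expn_succ_half a j : j.*2 <= a.+1 -> a.+1 ^ j <= 2 * a ^ j.
Proof.
case: (posnP a) => [->|a_gt0] le_j; first by case: j le_j => [|j] //; lia.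
have le_ja : j <= a by lia.
have := leq_expn_succ le_ja; set x := _ ^ j; set y := _ ^ j => le_xy.
rewrite -(leq_pmul2r (ltn0Sn a)); nia.
Qed.

(** An integral stand-in for [(1 + 1/a)^a <= e]: each half of the exponent contributes at most a
    factor 2. *)
Lemma leq_expn_succ_self a : a.+1 ^ a <= 4 * a ^ a.
Proof.
rewrite -[X in _ ^ X](odd_double_half a) -[X in a ^ X](odd_double_half a).
rewrite -addnn addnA !(expnD _ (_ + _)) (_ : 4 = 2 * 2) // mulnACA.
by apply: leq_mul; apply: leq_expn_succ_half; lia.
Qed.

Lemma leq_expnn_fact b : b ^ b <= 4 ^ b * b`!.
Proof.
elim: b => // b IH; rewrite expnS (leq_trans (leq_mul (leqnn _) (leq_expn_succ_self b))) //.
rewrite expnS factS [4 * 4 ^ b]mulnC -mulnA [b.+1 * _]mulnCA [4 ^ b * _]mulnCA.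
by rewrite leq_mul // [4 ^ b * _]mulnCA leq_mul.
Qed.

(** With weight [a^(|I| - |C|)], all subsets sum to [(a + 1)^|I|], while each small one weighs at
    least [a^(|I| - m)]. As [|I| <= a * m], the quotient is at most [(1 + 1/a)^(a * m) * a^m]. *)
Lemma card_small_sets (I : finType) a m : 0 < a -> #|I| <= a * m ->
  #|[set C : {set I} | #|C| <= m]| <= (4 * a) ^ m.
Proof.
move=> a_gt0 le_I; set Z := #|_|.
have total : \sum_(C : {set I}) a ^ (#|I| - #|C|) = a.+1 ^ #|I|.
  have := bigA_distr 1 addn (fun _ : I => 1) (fun _ => a).
  rewrite prod_nat_const => ->; apply: eq_big => // C _.
  rewrite (bigID (mem C)) /= big1 ?mul1n; last by move=> i ->.
  rewrite (eq_bigr (fun=> a)) => [|i /negPf -> //].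
  have -> : #|I| - #|C| = #|~: C| by rewrite [RHS]cardsCs setCK.
  by rewrite -[LHS]prod_nat_const; apply: eq_bigl => i; rewrite inE.
have le_Z : Z * a ^ (a * m - m) <= a.+1 ^ #|I| * a ^ (a * m - #|I|).
  rewrite -total big_distrl -sum_nat_const /= [leqRHS](bigID [pred C : {set I} | #|C| <= m]) /=.
  apply: leq_trans (leq_addr _ _); rewrite (eq_bigl (fun C : {set I} => #|C| <= m)).
    apply: leq_sum => C le_C; rewrite -expnD leq_pexp2l //.
    by have := max_card (mem C); lia.
  by move=> C; rewrite inE.
have le_pow : a.+1 ^ #|I| * a ^ (a * m - #|I|) <= 4 ^ m * a ^ (a * m).
  apply: (@leq_trans (a.+1 ^ (a * m))).
    rewrite -[in leqRHS](subnKC le_I) expnD leq_mul //.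
    by have [->//|k_gt0] := posnP (a * m - #|I|); rewrite leq_exp2r.
  rewrite !expnM -expnMn; have [->//|m_gt0] := posnP m.
  by rewrite leq_exp2r // leq_expn_succ_self.
have pow_gt0 : 0 < a ^ (a * m - m) by rewrite expn_gt0 a_gt0.
rewrite -(leq_pmul2r pow_gt0) (leq_trans le_Z) // (leq_trans le_pow) //.
by rewrite expnMn -mulnA -expnD subnKC // leq_pmull.
Qed.

Lemma nat_AGM (I : finType) (f : I -> nat) :
  (\prod_i f i) * #|I| ^ #|I| <= (\sum_i f i) ^ #|I|.
Proof.
have f_ge0 : {in I, forall i : I, (0 <= (f i)%:R *+ #|I| :> rat)%R}.
  by move=> i _; rewrite Num.Theory.mulrn_wge0 ?Num.Theory.ler0n.
have [+ _] := Num.Theory.leif_AGM_scaled f_ge0.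
rewrite -GRing.natr_sum -GRing.natrX.
under eq_bigr do rewrite -GRing.mulrnA.
by rewrite -GRing.natr_prod Num.Theory.ler_nat big_split /= prod_nat_const.
Qed.

Lemma pigeonhole_fiber (T U : finType) (f : T -> U) (P : {set T}) (Y : {pred U}) :
  0 < #|P| -> {in P, forall x, f x \in Y} ->
  exists2 y, y \in Y & #|P| <= #|Y| * #|[set x in P | f x == y]|.
Proof.
move=> /card_gt0P[x0 x0P] fY; pose F y := #|[set x in P | f x == y]|.
case: (arg_maxnP F (fY _ x0P)) => y yY max_y; exists y => //.
rewrite -sum1_card (partition_big f (mem Y)) //= -sum_nat_const.
apply: leq_sum => z zY; apply: leq_trans (max_y z zY).
by rewrite sum1dep_card leq_eqVlt eqxx.
Qed.

(** * Independence of path parities *)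

Definition parity (E : finType) (x : {ffun E -> bool}) (p : {set E}) : bool :=
  \big[addb/false]_(e in p) x e.

Definition flip (E : finType) (e : E) (x : {ffun E -> bool}) :=
  [ffun e' => x e' (+) (e' == e)].

Lemma flipK (E : finType) (e : E) : involutive (flip e).
Proof. by move=> x; apply/ffunP => e'; rewrite !ffunE -addbA addbb addbF. Qed.

Lemma parity_flip (E : finType) (e : E) x (p : {set E}) :
  parity (flip e x) p = parity x p (+) (e \in p).
Proof.
rewrite /parity (eq_bigr (fun e' => x e' (+) (e' == e))); last first.
  by move=> e' _; rewrite ffunE.
rewrite big_split /=; congr (_ (+) _); have [ep|eNp] := boolP (e \in p).
  by rewrite (bigD1 e) //= eqxx big1 // => e' /andP[_ /negPf].
by rewrite big1 // => e' e'p; apply: contraNF eNp => /eqP <-.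
Qed.

(* Among the given paths, those that bring in a new edge are independent: each *)
(* of them halves the number of labellings with the prescribed parities.       *)
Lemma parity_rank (E : finType) d (ps : seq {set E}) (a : {set E} -> bool) :
  all (fun p : {set E} => #|p| <= d) ps ->
  exists2 r, #|\bigcup_(p <- ps) p| <= d * r &
    #|[set x | all (fun p => parity x p == a p) ps]| * 2 ^ r <= 2 ^ #|E|.
Proof.
elim: ps => [|p ps IH] /=.
  exists 0; first by rewrite big_nil cards0.
  rewrite expn0 muln1 -[X in X ^ #|E|]card_bool -card_ffun; exact: max_card.
move=> /andP[le_p /IH[r le_r card_r]]; rewrite big_cons.
set U := \bigcup_(p <- ps) p in le_r *.
set F := [set x | all _ ps] in card_r.
set F' := [set x | _ && _].
have subF : F' \subset F by apply/subsetP => x; rewrite !inE => /andP[].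
have [pU|] := boolP (p \subset U).
  exists r; first by rewrite (setUidPr pU).
  by apply: leq_trans card_r; rewrite leq_mul2r subset_leq_card ?orbT.
move=> /subsetPn[e ep eNU].
exists r.+1.
  apply: leq_trans (leq_card_setU _ _) _; rewrite mulnS; exact: leq_add.
(* Flipping the new edge [e] toggles the parity of [p] and keeps those of [ps], so [F'] and its
   flipped image are disjoint subsets of [F] of equal size. *)
suff le_F : #|F'| * 2 <= #|F|.
  by rewrite expnS mulnA; apply: leq_trans card_r; rewrite leq_mul2r le_F orbT.
have flip_other x q : q \in ps -> parity (flip e x) q = parity x q.
  move=> q_ps; rewrite parity_flip (_ : e \in q = false) ?addbF //.
  apply: contraNF eNU => eq; rewrite /U; elim: (ps) q_ps => // q' qs IHq.
  rewrite inE big_cons inE => /orP[/eqP <-|/IHq ->]; first by rewrite eq.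
  by rewrite orbT.
have flipF x : (flip e x \in F) = (x \in F).
  by rewrite !inE; apply: eq_in_all => q q_ps; rewrite flip_other.
rewrite muln2 -addnn -[X in _ + X](card_imset _ (can_inj (flipK e))).
rewrite -cardsUI (_ : _ :&: _ = set0) ?cards0 ?addn0; last first.
  apply/setP => x; rewrite in_setI in_set0; apply/negP.
  case/andP => + /imsetP[y + def_x]; rewrite def_x !inE.
  case/andP => /eqP px _ /andP[/eqP py _].
  by move: px; rewrite parity_flip py ep addbT; case: (a p).
apply: subset_leq_card; apply/subsetP => x /setUP[/(subsetP subF)//|].
by case/imsetP => y /(subsetP subF) yF ->; rewrite flipF.
Qed.

(** * Routings of the butterfly *)

Local Notation digits d b := {ffun 'I_d -> 'I_b}.

(* (h, v, c) is the edge at level h that leaves v and sets its digit h to c.  *)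
Local Notation edge d b := ('I_d * digits d b * 'I_b)%type.

Definition set_digit (d b : nat) (v : digits d b) (h : nat) (c : 'I_b) :
    digits d b :=
  [ffun j : 'I_d => if j == h :> nat then c else v j].

(* Paths replace the digits of s by those of t from the most significant down. *)
Definition mix (d b : nat) (h : nat) (s t : digits d b) : digits d b :=
  [ffun j : 'I_d => if h <= j then t j else s j].

Definition bpath (d b : nat) (s t : digits d b) : {set edge d b} :=
  [set (h, mix h.+1 s t, t h) | h : 'I_d].

Lemma card_bpath d b (s t : digits d b) : #|bpath s t| <= d.
Proof. by apply: leq_trans (leq_imset_card _ _) _; rewrite card_ord. Qed.

(** With [h], these digits name the switch that [v] enters: the [b] nodes differing only in digit
    [h] share it. *)
Definition other_digits d b (h : 'I_d) (v : digits d b) : digits d.-1 b :=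
  [ffun j => v (lift h j)].

Definition insert_digit d b (h : 'I_d) (u : digits d.-1 b) (c : 'I_b) :
    digits d b :=
  [ffun j : 'I_d => if unlift h j is Some k then u k else c].

Lemma other_insert_digit d b (h : 'I_d) (u : digits d.-1 b) c :
  other_digits h (insert_digit h u c) = u.
Proof. by apply/ffunP => j; rewrite !ffunE liftK. Qed.

Lemma insert_digitE d b (h : 'I_d) (u : digits d.-1 b) c :
  insert_digit h u c h = c.
Proof. by rewrite ffunE unlift_none. Qed.

Lemma insert_other_digit d b (h : 'I_d) (v : digits d b) :
  insert_digit h (other_digits h v) (v h) = v.
Proof. by apply/ffunP => j; rewrite ffunE; case: unliftP => [k|] ->; rewrite ?ffunE. Qed.

(* A routing puts a permutation at every switch of the butterfly, hence links *)
(* all sources to all sinks by vertex-disjoint paths.                         *)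
Local Notation routing d b := {ffun 'I_d * digits d.-1 b -> {perm 'I_b}}.

Definition switch d b (f : routing d b) (h : 'I_d) (v : digits d b) : 'I_b :=
  f (h, other_digits h v) (v h).

Definition switch_step d b (f : routing d b) (h : 'I_d) (v : digits d b) : digits d b :=
  set_digit v h (switch f h v).

(** After [k <= d] steps the top [k] digits have been rewritten. [insub] fails only if [d = 0]. *)
Fixpoint route d b (f : routing d b) (k : nat) (s : digits d b) : digits d b :=
  if k is k'.+1 then
    let v := route f k' s in
    if insub (d - k) is Some h then switch_step f h v else v
  else s.

Lemma switch_step_inj d b (f : routing d b) h : injective (switch_step f h).
Proof.
move=> v v' eq_step.
have eq_j (j : 'I_d) : j != h -> v j = v' j.
  by move=> j_h; have /ffunP/(_ j) := eq_step; rewrite !ffunE val_eqE (negPf j_h).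
have eq_o : other_digits h v = other_digits h v'.
  by apply/ffunP => j; rewrite !ffunE eq_j // eq_sym neq_lift.
have /ffunP/(_ h) := eq_step; rewrite !ffunE eqxx /switch eq_o => /perm_inj eq_h.
by rewrite -(insert_other_digit h v) -(insert_other_digit h v') eq_o eq_h.
Qed.

Lemma route_inj d b (f : routing d b) k : injective (route f k).
Proof.
elim: k => [|k IH] s s' //=.
by case: insub => [h /switch_step_inj|] /IH.
Qed.

Lemma route_low d b (f : routing d b) k s (j : 'I_d) :
  j < d - k -> route f k s j = s j.
Proof.
elim: k => //= k IH lt_j; have lt_k : d - k.+1 < d by lia.
rewrite insubT ffunE ifF ?IH //=; first lia.
by apply/eqP; lia.
Qed.

Lemma route_high d b (f : routing d b) k k' s (j : 'I_d) :
  k <= k' <= d -> d - k <= j -> route f k' s j = route f k s j.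
Proof.
elim: k' => [|k' IH]; first by case: k.
case/andP; rewrite leq_eqVlt => /orP[/eqP-> //|le_k lt_k' le_j] /=.
have lt_h : d - k'.+1 < d by lia.
rewrite insubT ffunE ifF ?IH //=; first lia.
by apply/eqP; lia.
Qed.

(** Every digit is set once, so the node reached already has the top digits of the final sink and
    the low ones of the source: the routing follows the butterfly path. *)
Lemma route_mix d b (f : routing d b) k s : k <= d ->
  mix (d - k) s (route f d s) = route f k s.
Proof.
move=> le_k; apply/ffunP => j; rewrite ffunE; case: leqP => [le_j|lt_j].
  by apply: route_high; rewrite ?le_k /=.
by rewrite route_low.
Qed.

(** A partial route is injective on a finite set, hence onto: at every level, every node is visited
    from some source. *)
Lemma switch_in_bpath d b (f : routing d b) (h : 'I_d) v :
  exists s, (h, v, switch f h v) \in bpath s (route f d s).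
Proof.
have lt_h := ltn_ord h; have [g _ gK] := injF_bij (@route_inj _ _ f (d - h.+1)).
exists (g v); apply/imsetP; exists h => //.
have -> : h.+1 = d - (d - h.+1) by lia.
rewrite route_mix ?gK; last lia.
rewrite (@route_high _ _ f (d - h)); [|lia|lia].
have -> : d - h = (d - h.+1).+1 by lia.
rewrite /= gK; have e : d - (d - h.+1).+1 = h by lia.
rewrite e insubT ffunE /= eqxx.
by congr (_, switch f _ _); exact: val_inj.
Qed.

Definition out_degree d b (U : {set edge d b}) (hv : 'I_d * digits d b) : nat :=
  #|[set c | (hv, c) \in U]|.

Lemma sum_out_degree d b (U : {set edge d b}) :
  \sum_hv out_degree U hv = #|U|.
Proof.
rewrite -sum1_card [RHS]big_mkcond /=.
under eq_bigr do rewrite /out_degree -sum1_card big_mkcond /=.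
by rewrite pair_bigA /=; apply: eq_bigr => -[hv c] _ /=; rewrite inE.
Qed.

(** Switches are set independently, and one switch has at most as many admissible permutations as
    functions picking an edge of [U] out of each of its [b] nodes. *)
Lemma card_routing_in d b (U : {set edge d b}) :
  #|[set f : routing d b | [forall h, forall v, (h, v, switch f h v) \in U]]|
    <= \prod_hv out_degree U hv.
Proof.
pose F (hu : 'I_d * digits d.-1 b) : pred {perm 'I_b} :=
  [pred p : {perm 'I_b} | [forall c, (hu.1, insert_digit hu.1 hu.2 c, p c) \in U]].
have card_F hu : #|F hu| <= \prod_c out_degree U (hu.1, insert_digit hu.1 hu.2 c).
  pose H c := [pred c' | (hu.1, insert_digit hu.1 hu.2 c, c') \in U].
  have -> : \prod_c out_degree U (hu.1, insert_digit hu.1 hu.2 c) = #|family H|.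
    rewrite card_family foldrE big_map big_enum /=.
    by apply: eq_bigr => c _; apply: eq_card => c'; rewrite !inE.
  have pval_inj : injective (@pval 'I_b) by exact: val_inj.
  rewrite -(card_imset (F hu) pval_inj); apply: subset_leq_card.
  apply/subsetP => _ /imsetP[p /forallP pF ->]; apply/familyP => c.
  by rewrite inE pvalE.
have -> : \prod_hv out_degree U hv = \prod_(hu : 'I_d * digits d.-1 b)
    \prod_c out_degree U (hu.1, insert_digit hu.1 hu.2 c).
  rewrite pair_bigA /=; pose g (x : 'I_d * digits d.-1 b * 'I_b) :=
    (x.1.1, insert_digit x.1.1 x.1.2 x.2).
  rewrite (reindex g) //=.
  exists (fun hv => ((hv.1, other_digits hv.1 hv.2), hv.2 hv.1)) => [[[h u] c]|[h v]] _.
    by rewrite /g /= other_insert_digit insert_digitE.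
  by rewrite /g /= insert_other_digit.
apply: (@leq_trans #|family F|).
  apply: subset_leq_card; apply/subsetP => f; rewrite inE => /forallP fU.
  apply/familyP => -[h u]; apply/forallP => c /=.
  have /forallP/(_ (insert_digit h u c)) := fU h.
  by rewrite /switch other_insert_digit insert_digitE.
by rewrite card_family foldrE big_map big_enum /=; apply: leq_prod.
Qed.

(** * The cells read by a query *)

Fixpoint probed (w : nat) (A : Type) (q : probe_tree w A)
    (mem : seq (w.-tuple bool)) : seq nat :=
  match q with
  | Answer _ => [::]
  | Probe a next => a :: probed (next (read_cell mem a)) mem
  end.

Lemma size_probed w (A : Type) (q : probe_tree w A) mem :
  size (probed q mem) = probes q mem.
Proof. by elim: q => //= a next IH; rewrite IH. Qed.

Lemma probed_agree w (A : Type) (q : probe_tree w A) mem mem' :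
  {in probed q mem, read_cell mem =1 read_cell mem'} ->
  answer q mem = answer q mem' /\ probed q mem = probed q mem'.
Proof.
elim: q => //= a next IH agree.
rewrite -(agree a (mem_head _ _)).
have [|-> ->] // := IH (read_cell mem a).
by move=> c c_in; apply: agree; rewrite inE c_in orbT.
Qed.

(** * The cell-probe lower bound *)

Lemma read_cell_default w (mem : seq (w.-tuple bool)) a :
  size mem <= a -> read_cell mem a = nseq_tuple w false.
Proof. exact: nth_default. Qed.

Definition probed_cells (w : nat) (A : Type) (S : nat) (q : probe_tree w A)
    (mem : seq (w.-tuple bool)) : {set 'I_S} :=
  [set i : 'I_S | (i : nat) \in probed q mem].

Lemma card_probed_cells w (A : Type) S (q : probe_tree w A) mem :
  #|probed_cells S q mem| <= probes q mem.
Proof.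
rewrite -size_probed cardE -(size_map val); apply: uniq_leq_size.
  by rewrite (map_inj_uniq val_inj) enum_uniq.
by move=> _ /mapP[i + ->]; rewrite mem_enum inE.
Qed.

(* A cell set of size m, chosen by pigeonhole among those that serve a whole  *)
(* routing, answers the same queries for all labellings with equal contents.  *)
Lemma butterfly_certificate (A : eqType) (letter : bool -> A) d b w t S
    (memo : {ffun edge d b -> bool} -> seq (w.-tuple bool))
    (q : digits d b -> digits d b -> probe_tree w A) :
  injective letter ->
  (forall x, size (memo x) <= S) ->
  (forall x s s', answer (q s s') (memo x) = letter (parity x (bpath s s'))) ->
  (forall x s s', probes (q s s') (memo x) <= t) ->
  let m := b ^ d * t in
  let Z := #|[set C : {set 'I_S} | #|C| <= m]| in
  exists (U : {set edge d b}) (r : nat),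
    [/\ #|U| <= d * r, 2 ^ r <= Z * 2 ^ (w * m) &
        b`! ^ (d * b ^ d.-1) <= Z * \prod_hv out_degree U hv].
Proof.
move=> letter_inj szm ans_ok pr_le m Z.
pose cells x (f : routing d b) :=
  \bigcup_s probed_cells S (q s (route f d s)) (memo x).
have card_cells x f : #|cells x f| <= m.
  apply: (@leq_trans (\sum_(s : digits d b) t)).
    rewrite /cells; elim/big_rec2: _ => [|s k C _ le_C]; first by rewrite cards0.
    apply: leq_trans (leq_card_setU _ _) _; apply: leq_add => //.
    exact: leq_trans (card_probed_cells _ _ _) _.
  by rewrite sum_nat_const card_ffun !card_ord.
(* For each labelling, some cell set serves at least a [1/Z] fraction of all routings. *)
have /fin_all_exists[Cx CxP] : forall x, exists C : {set 'I_S}, #|C| <= m /\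
    b`! ^ (d * b ^ d.-1) <= Z * #|[set f | cells x f == C]|.
  move=> x; have := @pigeonhole_fiber _ _ (cells x) setT
    (mem [set C : {set 'I_S} | #|C| <= m]).
  case=> [|f _|C]; [|by rewrite inE|].
    by apply/card_gt0P; exists [ffun=> 1%g].
  rewrite inE cardsT card_ffun card_prod card_ffun !card_ord card_Sn => le_C le_f.
  exists C; split=> //; apply: leq_trans le_f _; rewrite leq_mul //.
  by apply: subset_leq_card; apply/subsetP => f; rewrite !inE.
have cardX : #|[set: {ffun edge d b -> bool}]| = 2 ^ #|{: edge d b}|.
  by rewrite cardsT card_ffun card_bool.
(* One set [C] is the choice of at least a [1/Z] fraction of the labellings; fixing its contents
   then loses a factor of at most [2^(w * |C|)]. *)
have [||C _ le_F1] := @pigeonhole_fiber _ _ Cx setT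
    (mem [set C : {set 'I_S} | #|C| <= m]).
- by rewrite cardX expn_gt0.
- by move=> x _; rewrite inE; case: (CxP x).
rewrite cardX in le_F1; set F1 := [set x in setT | _] in le_F1.
have F1_gt0 : 0 < #|F1|.
  rewrite lt0n; apply: contraTneq le_F1 => ->; rewrite muln0 -ltnNge.
  by rewrite expn_gt0.
have CxF1 x : x \in F1 -> Cx x = C by rewrite !inE /= => /eqP.
have le_C : #|C| <= m.
  by case/card_gt0P: F1_gt0 => x /CxF1 <-; case: (CxP x).
pose content x : {ffun 'I_S -> w.-tuple bool} :=
  [ffun i : 'I_S => if i \in C then read_cell (memo x) i else nseq_tuple w false].
have [x _|f _ le_F] := @pigeonhole_fiber _ _ content F1
    (mem (pffun_on (nseq_tuple w false) C predT)) F1_gt0.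
  apply/pffun_onP; split=> //; apply/subsetP => i.
  by rewrite inE ffunE; case: ifP => // _; rewrite eqxx.
rewrite card_pffun_on (_ : #|predT| = 2 ^ w) in le_F; last first.
  by rewrite -[in RHS]card_bool -card_tuple; apply: eq_card.
set F := [set x in F1 | _] in le_F.
have contF x (i : 'I_S) : x \in F -> i \in C -> f i = read_cell (memo x) i.
  by rewrite !inE => /andP[_ /eqP <-] iC; rewrite ffunE iC.
(* [memf] stands for all labellings of [F] at once: their common contents on [C], zeros
   elsewhere. *)
pose memf := [seq f i | i <- enum 'I_S].
have szf : size memf = S by rewrite size_map size_enum_ord.
have agree x a : x \in F -> (forall i : 'I_S, i = a :> nat -> i \in C) ->
    read_cell memf a = read_cell (memo x) a.
  move=> xF aC; have [lt_a|le_a] := ltnP a S; last first.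
    by rewrite !read_cell_default ?szf // (leq_trans (szm x)).
  rewrite /read_cell (nth_map (Ordinal lt_a)) ?size_enum_ord //.
  have -> : nth (Ordinal lt_a) (enum 'I_S) a = Ordinal lt_a.
    exact: nth_ord_enum (Ordinal lt_a) (Ordinal lt_a).
  by apply: contF => //; apply: aC.
have F_gt0 : 0 < #|F|.
  by rewrite lt0n; apply: contraTneq le_F => ->; rewrite muln0 -ltnNge.
(* Queries that, run on [memf], read no cell below [S] outside [C]. Addresses from [S] on read as
   zero in every memory, so the answers are common to all of [F]. *)
pose Q := [set ss : digits d b * digits d b |
  probed_cells S (q ss.1 ss.2) memf \subset C].
have parityQ x y ss : x \in F -> y \in F -> ss \in Q ->
    parity x (bpath ss.1 ss.2) = parity y (bpath ss.1 ss.2).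
  suff ansQ z : z \in F -> ss \in Q ->
      answer (q ss.1 ss.2) memf = letter (parity z (bpath ss.1 ss.2)).
    by move=> xF yF ssQ; apply: letter_inj; rewrite -!ansQ.
  move=> zF; rewrite inE => /subsetP ssQ; rewrite -ans_ok.
  have [|-> //] := @probed_agree _ _ (q ss.1 ss.2) memf (memo z).
  by move=> a a_in; apply: agree => // i def_i; apply: ssQ; rewrite inE def_i.
have [x0 x0F] := card_gt0P F_gt0.
have Cx0 : Cx x0 = C by apply: CxF1; move: x0F; rewrite inE => /andP[].
pose ps := [seq bpath ss.1 ss.2 | ss <- enum Q].
have [|r le_U le_r] := @parity_rank _ d ps (parity x0).
  by apply/allP => _ /mapP[ss _ ->]; exact: card_bpath.
exists (\bigcup_(p <- ps) p), r; split=> //.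
  have sub_F : #|F| <= #|[set x | all (fun p => parity x p == parity x0 p) ps]|.
    apply: subset_leq_card; apply/subsetP => x xF; rewrite inE.
    apply/allP => _ /mapP[ss + ->]; rewrite mem_enum => ssQ.
    by apply/eqP; exact: parityQ.
  have F_r : #|F| * 2 ^ r <= 2 ^ #|{: edge d b}|.
    by apply: leq_trans le_r; rewrite leq_mul2r sub_F orbT.
  (* Independence gives [|F| * 2^r <= 2^|E|], the pigeonholes [2^|E| <= Z * 2^(w * m) * |F|]; [|F|]
     cancels. *)
  rewrite -(leq_pmul2l F_gt0) (leq_trans F_r) // (leq_trans le_F1) //.
  rewrite [leqRHS]mulnCA leq_mul //; apply: leq_trans le_F _.
  by rewrite mulnC leq_mul // -expnM leq_pexp2l // leq_mul2l le_C orbT.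
have [_ le_f] := CxP x0; apply: leq_trans le_f _; rewrite leq_mul //.
apply: leq_trans (card_routing_in _); apply: subset_leq_card.
apply/subsetP => g; rewrite !inE Cx0 => /eqP def_C.
apply/forallP => h; apply/forallP => v.
(* The edge chosen at [v] lies on a routed path, whose query is in [Q] because [C] is exactly the
   set of cells used by the routing. *)
have [s e_in] := switch_in_bpath g h v.
have sQ : (s, route g d s) \in Q.
  rewrite inE /= (_ : probed_cells _ _ _ = probed_cells S (q s (route g d s)) (memo x0)).
    by rewrite -def_C; exact: bigcup_sup.
  have [|_ e] := @probed_agree _ _ (q s (route g d s)) (memo x0) memf; last first.
    by rewrite /probed_cells e.
  move=> a a_in; apply/esym/agree => // i def_i; rewrite -def_C.
  by apply/bigcupP; exists s => //; rewrite inE def_i.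
have : bpath s (route g d s) \in ps.
  by apply/mapP; exists (s, route g d s); rewrite ?mem_enum.
elim: (ps) => // p ps' IH; rewrite inE big_cons inE => /orP[/eqP <-|/IH ->].
  by rewrite e_in.
by rewrite orbT.
Qed.

(** The degree is a square with root [2^beta]. The mean out-degree of [U] is at most
    [(rho + 2 + w) * t], a quarter of that root; the quarter absorbs the loss in [b! >= b^b / 4^b].
    The exponents then satisfy [2 * beta * d <= (rho + 2) * t + beta * d]. *)
Lemma butterfly_lower_bound (A : eqType) (letter : bool -> A) d beta rho w t S
    (memo : {ffun edge d (2 ^ beta.*2) -> bool} -> seq (w.-tuple bool))
    (q : digits d (2 ^ beta.*2) -> digits d (2 ^ beta.*2) -> probe_tree w A) :
  injective letter ->
  (forall x, size (memo x) <= S) ->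
  (forall x s s', answer (q s s') (memo x) = letter (parity x (bpath s s'))) ->
  (forall x s s', probes (q s s') (memo x) <= t) ->
  S <= 2 ^ rho * (2 ^ (beta.*2 * d) * t) ->
  4 * ((rho.+2 + w) * t) <= 2 ^ beta ->
  beta * d <= rho.+2 * t.
Proof.
move=> letter_inj szm ans_ok pr_le le_S le_beta.
have [->|d_gt0] := posnP d; first by rewrite muln0.
have [U [r [le_U le_r le_f]]] := butterfly_certificate letter_inj szm ans_ok pr_le.
set b := 2 ^ beta.*2 in U le_U le_f le_r *; set Z := #|_| in le_r le_f.
have [b_gt0 n_gt0] : 0 < b /\ 0 < b ^ d by rewrite !expn_gt0.
have le_Z : Z <= 2 ^ (rho.+2 * (b ^ d * t)).
  rewrite expnM 2!expnS mulnA; apply: card_small_sets; first by rewrite expn_gt0.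
  by rewrite card_ord -expnM.
have le_r' : r <= (rho.+2 + w) * (b ^ d * t).
  rewrite -(leq_exp2l (m := 2)) // (leq_trans le_r) //.
  by rewrite mulnDl expnD leq_mul2r le_Z orbT.
have le_prod : \prod_hv out_degree U hv <= ((rho.+2 + w) * t) ^ (d * b ^ d).
  have := nat_AGM (out_degree U).
  rewrite sum_out_degree card_prod card_ffun !card_ord => le_prod.
  have N_gt0 : 0 < d * b ^ d by rewrite muln_gt0 d_gt0.
  have NN_gt0 : 0 < (d * b ^ d) ^ (d * b ^ d) by rewrite expn_gt0 N_gt0.
  rewrite -(leq_pmul2r NN_gt0) (leq_trans le_prod) // -expnMn leq_exp2r //.
  apply: leq_trans le_U _; rewrite mulnCA leq_mul2l; apply/orP; right.
  by apply: leq_trans le_r' _; rewrite [b ^ d * t]mulnC mulnA.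
have e_n : b ^ d = b * b ^ d.-1 by rewrite -expnS prednK.
have : b ^ (d * b ^ d) <= 2 ^ (rho.+2 * (b ^ d * t)) * (2 ^ beta) ^ (d * b ^ d).
  rewrite [in leqLHS]e_n mulnCA expnM.
  apply: (@leq_trans ((4 ^ b * b`!) ^ (d * b ^ d.-1))).
    by rewrite leq_exp2r ?leq_expnn_fact // muln_gt0 d_gt0 expn_gt0 b_gt0.
  rewrite expnMn -expnM mulnCA -e_n.
  apply: (leq_trans (leq_mul (leqnn _) le_f)); rewrite mulnCA leq_mul //.
  apply: (leq_trans (leq_mul (leqnn _) le_prod)); rewrite -expnMn leq_exp2r //.
  by rewrite muln_gt0 d_gt0.
rewrite -!expnM -expnD leq_exp2l // => le_exp.
rewrite -(leq_pmul2r n_gt0); move: le_exp; rewrite -muln2; nia.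
Qed.

(** * Texts from butterflies *)

Lemma size_flatten_uniform (I A : Type) (f : I -> seq A) k r :
  (forall i, size (f i) = k) -> size (flatten [seq f i | i <- r]) = size r * k.
Proof. by move=> szf; elim: r => //= i r IH; rewrite size_cat szf IH mulSn. Qed.

Lemma nth_flatten_uniform (I A : Type) (x0 : A) (i0 : I) (f : I -> seq A) k r c j :
  (forall i, size (f i) = k) -> c < size r -> j < k ->
  nth x0 (flatten [seq f i | i <- r]) (c * k + j) = nth x0 (f (nth i0 r c)) j.
Proof.
move=> szf; elim: r c => //= i r IH [|c] lt_c lt_j.
  by rewrite mul0n nth_cat szf lt_j.
rewrite nth_cat szf ifF; last by rewrite mulSn; lia.
by rewrite mulSn -addnA addKn IH.
Qed.

Definition edge_bit d b (x : {ffun edge d b -> bool}) (h : nat)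
    (v : digits d b) (c : 'I_b) : bool :=
  if insub h is Some i then x (i, v, c) else false.

(* Parities, shifted by e, of the paths from v at level h to all the sinks,   *)
(* whose digits below h vary in lexicographic order.                          *)
Fixpoint node_word (A : Type) (letter : bool -> A) d b
    (x : {ffun edge d b -> bool}) (h : nat) (v : digits d b) (e : bool) : seq A :=
  if h is h'.+1 then
    flatten [seq node_word letter x h' (set_digit v h' c) (e (+) edge_bit x h' v c)
            | c <- enum 'I_b]
  else [:: letter e].

(** The digits of [t] below [h] read as a number in base [b]: the offset of the sink in the word of
    a node at level [h]. *)
Fixpoint sink_pos d b (h : nat) (t : digits d b) : nat :=
  if h is h'.+1 then
    (if insub h' is Some i then t i * b ^ h' else 0) + sink_pos h' t
  else 0.

Definition butterfly_text (A : Type) (letter : bool -> A) d b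
    (x : {ffun edge d b -> bool}) (n : nat) : seq A :=
  flatten [seq node_word letter x d s false | s <- enum {: digits d b}] ++
  nseq (n - b ^ d * b ^ d) (letter false).

Definition text_pos d b (s t : digits d b) : nat :=
  enum_rank s * b ^ d + sink_pos d t.

Lemma size_node_word (A : Type) (letter : bool -> A) d b
    (x : {ffun edge d b -> bool}) h v e :
  size (node_word letter x h v e) = b ^ h.
Proof.
elim: h v e => //= h IH v e; rewrite expnS.
pose f c := node_word letter x h (set_digit v h c) (e (+) edge_bit x h v c).
by rewrite (@size_flatten_uniform _ _ f (b ^ h)) ?size_enum_ord // => c; exact: IH.
Qed.

Lemma sink_pos_lt d b h (t : digits d b) : h <= d -> sink_pos h t < b ^ h.
Proof.
elim: h => //= h IH lt_h; rewrite insubT expnS.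
have := IH (ltnW lt_h); have := ltn_ord (t (Sub h lt_h)); nia.
Qed.

Lemma size_butterfly_text (A : Type) (letter : bool -> A) d b
    (x : {ffun edge d b -> bool}) n :
  b ^ d * b ^ d <= n -> size (butterfly_text letter x n) = n.
Proof.
move=> le_n; rewrite size_cat size_nseq.
rewrite (size_flatten_uniform _ (k := b ^ d)); last first.
  by move=> s; exact: size_node_word.
by rewrite -cardE card_ffun !card_ord subnKC.
Qed.

Lemma mix_full d b (s t : digits d b) : mix d s t = s.
Proof. by apply/ffunP => j; rewrite ffunE leqNgt ltn_ord. Qed.

Lemma set_digit_mix d b (s t : digits d b) (h : 'I_d) :
  set_digit (mix h.+1 s t) h (t h) = mix h s t.
Proof.
apply/ffunP => j; rewrite !ffunE [h <= j]leq_eqVlt eq_sym.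
by have [/val_inj ->|] := eqVneq (h : nat) j.
Qed.

Lemma parity_bpath d b (x : {ffun edge d b -> bool}) s t :
  parity x (bpath s t) = \big[addb/false]_(h < d) x (h, mix h.+1 s t, t h).
Proof. by rewrite /parity /bpath big_imset //= => h h' _ _ []. Qed.

Lemma nth_node_word (A : Type) (x0 : A) (letter : bool -> A) d b
    (x : {ffun edge d b -> bool}) h s t e : h <= d ->
  nth x0 (node_word letter x h (mix h s t) e) (sink_pos h t) =
  letter (e (+) \big[addb/false]_(i < d | i < h) x (i, mix i.+1 s t, t i)).
Proof.
elim: h e => [|h IH] e lt_h /=; first by rewrite big1 ?addbF // => i.
rewrite insubT; set i : 'I_d := Sub h lt_h.
pose f c := node_word letter x h (set_digit (mix h.+1 s t) h c)
  (e (+) edge_bit x h (mix h.+1 s t) c).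
rewrite (@nth_flatten_uniform _ _ _ (t i) f (b ^ h)); last first.
- exact: sink_pos_lt (ltnW lt_h).
- by rewrite size_enum_ord.
- by move=> c; exact: size_node_word.
rewrite nth_ord_enum /f (set_digit_mix s t i) (IH _ (ltnW lt_h)).
rewrite /edge_bit insubT -/i -addbA [in RHS](bigD1 i) //=.
congr (letter (_ (+) (_ (+) _))); apply: eq_bigl => j.
by rewrite ltnS ltn_neqAle andbC.
Qed.

Lemma text_pos_lt d b (s t : digits d b) : text_pos s t < b ^ d * b ^ d.
Proof.
have := sink_pos_lt t (leqnn d); have := ltn_ord (enum_rank s).
rewrite [X in _ < X -> _]card_ffun !card_ord /text_pos; nia.
Qed.

Lemma nth_butterfly_text (A : Type) (x0 : A) (letter : bool -> A) d b
    (x : {ffun edge d b -> bool}) n s t :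
  nth x0 (butterfly_text letter x n) (text_pos s t) = letter (parity x (bpath s t)).
Proof.
have szw v : size (node_word letter x d v false) = b ^ d by exact: size_node_word.
rewrite nth_cat (size_flatten_uniform _ szw) -cardE card_ffun !card_ord.
rewrite text_pos_lt (nth_flatten_uniform _ s) //; last first.
- exact: sink_pos_lt.
- by rewrite -cardE.
rewrite nth_enum_rank -[s in node_word _ _ _ s](mix_full s t) nth_node_word //.
by rewrite parity_bpath addFb; congr letter; apply: eq_bigl => i; rewrite ltn_ord.
Qed.

(** Each level has two words per node, one for each shift, and each concatenates [b] words of the
    level below. The other terms are for the two letters, joining the sources, and the padding,
    built by doubling and then appended. *)
Lemma butterfly_text_chainable (A : eqType) (letter : bool -> A) d b
    (x : {ffun edge d b -> bool}) n l : 0 < b -> n < 2 ^ l ->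
  chainable (2 + b * (b ^ d).*2 * d + b ^ d + l.*2 + 1)
    [:: butterfly_text letter x n].
Proof.
move=> b_gt0 lt_n.
pose ws h := [seq node_word letter x h v e | v <- enum {: digits d b},
  e <- [:: false; true]].
have ws_in h v e : node_word letter x h v e \in ws h.
  by apply: allpairs_f; rewrite ?mem_enum //; case: e.
have sz_ws h : size (ws h) = (b ^ d).*2.
  by rewrite size_allpairs -cardE card_ffun !card_ord muln2.
have ch_ws h : chainable (2 + b * (b ^ d).*2 * h) (ws h ++ [:: [:: letter false]]).
  elim: h => [|h IH].
    exists [:: [:: letter false]; [:: letter true]]; split=> //.
      by case=> [|[|]] // _; left; [exists (letter false)|exists (letter true)].
    move=> w; rewrite mem_cat => /orP[/allpairsP[[v e] [_ _ ->]]|].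
      by case: e; rewrite !inE eqxx ?orbT.
    by rewrite !inE => ->.
  have := chainable_flattens IH (b := b) (ws := ws h.+1).
  rewrite sz_ws -addnA -mulnSr => ch.
  apply: (chainable_sub (ch _)) => //.
    move=> _ /allpairsP[[v e] [_ _ ->]] /=; eexists; split; last by [].
    - by rewrite -size_eq0 size_map size_enum_ord -lt0n.
    - by rewrite size_map size_enum_ord.
    - by move=> _ /mapP[c _ ->]; rewrite mem_cat ws_in.
  by move=> w; rewrite !mem_cat => /orP[|] ->; rewrite ?orbT.
pose us := [seq node_word letter x d s false | s <- enum {: digits d b}].
have sz_us : size us = b ^ d by rewrite size_map -cardE card_ffun !card_ord.
have [||ps chP] := chainable_flatten (ch_ws d) (us := us).
- by rewrite -size_eq0 sz_us -lt0n expn_gt0 b_gt0.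
- by move=> _ /mapP[s _ ->]; rewrite mem_cat ws_in.
have ch : chainable (2 + b * (b ^ d).*2 * d + b ^ d)
    (flatten us :: (ws d ++ [:: [:: letter false]])).
  by rewrite sz_us in chP; exists ps.
rewrite /butterfly_text -/us; have [->|pad_gt0] := posnP (n - b ^ d * b ^ d).
  rewrite cats0; apply: (chainable_sub ch); first by rewrite -!addnA !leq_add2l leq_addr.
  by move=> w; rewrite !inE => ->.
have lf : [:: letter false] \in flatten us :: (ws d ++ [:: [:: letter false]]).
  by rewrite inE mem_cat mem_seq1 eqxx !orbT.
have lt_pad : n - b ^ d * b ^ d < 2 ^ l by apply: leq_ltn_trans lt_n; exact: leq_subr.
have ch2 := chainable_nseq ch lf pad_gt0 lt_pad.
have := chainable_cat ch2 (u := flatten us) (v := nseq (n - b ^ d * b ^ d) (letter false)).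
rewrite !inE !eqxx orbT -addn1 => /(_ isT isT) ch3.
by apply: (chainable_sub ch3) => // w; rewrite !inE => ->.
Qed.

(** The contrapositive of [butterfly_lower_bound], two letters of the alphabet standing for the
    bits. [S] need only bound the memory for representations as small as the chain provides. *)
Lemma many_probes (m : dict_measure) (Sigma : nat -> finType)
    (D : access_structure m Sigma) n d beta rho t l S :
  1 < #|Sigma n| -> solves_access D ->
  let b := 2 ^ beta.*2 in
  b ^ d * b ^ d <= n -> n < 2 ^ l ->
  (forall (T : n.-tuple (Sigma n)) (X : representation m (Sigma n) n),
     is_repr_of T X ->
     repr_size X <= (2 + b * (b ^ d).*2 * d + b ^ d + l.*2 + 1).+1 ->
     size (memory D T X) <= S) ->
  S <= 2 ^ rho * (2 ^ (beta.*2 * d) * t) ->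
  4 * ((rho.+2 + word_size D n) * t) <= 2 ^ beta ->
  rho.+2 * t < beta * d ->
  exists (T : n.-tuple (Sigma n)) (X : representation m (Sigma n) n) (i : 'I_n),
    is_repr_of T X /\ t < probes (query D i) (memory D T X).
Proof.
move=> /card_gt1P[a0 [a1 [_ _ neq_a]]] D_ok b le_n lt_n le_mem le_S le_beta lt_d.
have b_gt0 : 0 < b by rewrite expn_gt0.
pose letter e := if e then a1 else a0.
have letter_inj : injective letter.
  by move=> [] [] //= e; move: neq_a; rewrite /= e eqxx.
pose T x := Tuple (introT eqP (size_butterfly_text letter x le_n)).
have /fin_all_exists[X XP] : forall x, exists X : representation m (Sigma n) n,
    is_repr_of (T x) X /\ repr_size X <= (2 + b * (b ^ d).*2 * d + b ^ d + l.*2 + 1).+1.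
  by move=> x; apply: repr_of_chain; exact: butterfly_text_chainable.
have lt_pos (s s' : digits d b) := leq_trans (text_pos_lt s s') le_n.
pose q s s' := query D (Ordinal (lt_pos s s')).
have [/existsP[x /existsP[s /existsP[s' lt_t]]]|] := boolP [exists x, [exists s,
    [exists s', t < probes (q s s') (memory D (T x) (X x))]]].
  by exists (T x), (X x), (Ordinal (lt_pos s s')); split=> //; case: (XP x).
rewrite negb_exists => /forallP no_x; exfalso; move: lt_d; apply/negP; rewrite -leqNgt.
apply: (@butterfly_lower_bound _ letter _ _ _ _ _ S
  (fun x => memory D (T x) (X x)) q) => //.
- by move=> x; case: (XP x) => repr_x le_x; exact: le_mem.
- move=> x s s'; case: (XP x) => repr_x _; rewrite D_ok //.
  by rewrite (tnth_nth a0) /= nth_butterfly_text.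
- move=> x s s'; have := no_x x; rewrite negb_exists => /forallP/(_ s).
  by rewrite negb_exists => /forallP/(_ s'); rewrite -leqNgt.
Qed.

(** * Choice of the parameters *)

Lemma leq_sqr_exp2 q : 4 <= q -> q * q <= 2 ^ q.
Proof.
elim: q => // q IH le_q; have [-> //|q_neq3] := eqVneq q 3.
have le4q : 4 <= q by lia.
by have := IH le4q; rewrite expnS; nia.
Qed.

Lemma chain_size_bound b N d l p : 0 < b -> 0 < N -> 9 <= p -> d <= p -> l <= p ->
  (2 + b * N.*2 * d + N + l.*2 + 1).+1 <= p ^ 2 * (b * N).
Proof.
move=> b_gt0 N_gt0 p_ge d_le l_le.
have bN_N : N <= b * N by rewrite leq_pmull.
have -> : b * N.*2 * d = b * N * d.*2 by rewrite -!muln2; lia.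
have bN_gt0 : 0 < b * N by rewrite muln_gt0 b_gt0.
move: (b * N) bN_N bN_gt0 => K N_K K_gt0.
have le1 : l.*2 + 4 <= K * (l.*2 + 4) by rewrite leq_pmull.
have le9 : 9 * p <= p * p by rewrite leq_mul2r p_ge orbT.
have le2 : K * (d.*2 + 1 + (l.*2 + 4)) <= K * (p * p).
  by rewrite leq_mul2l; apply/orP; right; lia.
rewrite 2!mulnDr muln1 in le2; rewrite mulnC -mulnn; lia.
Qed.

(** [l] is to be the bit length of [n]. The depth is the largest with [16 * q * d <= l - 1], so that
    the [2^(16 * q * d)] pairs of source and sink fit in the text; [t] is the largest number of
    probes below the threshold of [butterfly_lower_bound]. *)
Lemma butterfly_parameters k q l : 8 * (k + 18) <= q -> 4 * (k + 18) * q < l ->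
  let d := l.-1 %/ (16 * q) in
  let beta := 4 * q in
  let rho := (k + 11) * q in
  let t := (beta * d).-1 %/ rho.+2 in
  [/\ 4 * (beta * d) <= l.-1, 0 < t <= l, rho.+2 <= (k + 12) * q,
      rho.+2 * t < beta * d &
      forall pr, t < pr -> l <= 4 * (k + 17) * q * pr].
Proof.
move=> k_le l_big d beta rho t.
have q_gt0 : 0 < q by lia.
have l_d : 4 * (beta * d) <= l.-1 < 4 * (beta * d) + 16 * q.
  have q16_gt0 : 0 < 16 * q by rewrite muln_gt0.
  have := divn_eq l.-1 (16 * q); have := ltn_pmod l.-1 q16_gt0.
  rewrite -/d /beta; move: (_ %% _) => r lt_r ->; clear -lt_r; nia.
have bd_t : rho.+2 * t <= (beta * d).-1 < rho.+2 * t + rho.+2.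
  have := divn_eq (beta * d).-1 rho.+2; have := ltn_pmod (beta * d).-1 (ltn0Sn rho.+1).
  by rewrite -/t; move: (_ %% _) => r lt_r ->; rewrite mulnC leq_addr ltn_add2l.
have rho_le : rho.+2 <= (k + 12) * q by rewrite /rho; lia.
clearbody beta d rho t.
have t_gt0 : 0 < t.
  rewrite lt0n; apply/eqP => t0; move: bd_t; rewrite t0 muln0; lia.
have t_rho : t <= rho.+2 * t by rewrite leq_pmull.
split=> //; [lia|lia|lia|move=> pr lt_t].
have : (k + 12) * q * t.+1 <= (k + 12) * q * pr by rewrite leq_mul2l lt_t orbT.
have : rho.+2 * t.+1 <= (k + 12) * q * t.+1 by rewrite leq_mul2r rho_le orbT.
have : q <= q * pr by rewrite leq_pmulr // (leq_trans _ lt_t).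
by move: l_d bd_t; rewrite mulnS; clear; lia.
Qed.

(** All quantities are compared with powers of [p = 2^q >= l], which reduces products to sums of
    exponents. The double exponential bound on [n] makes [q] exceed the constants coming from [k],
    [c1] and [c2]. *)
Lemma access_lower_bound_nat (m : dict_measure) (Sigma : nat -> finType)
    (D : access_structure m Sigma) n c1 c2 k :
  1 < #|Sigma n| -> solves_access D ->
  let l := (trunc_log 2 n).+1 in
  let q := up_log 2 l in
  2 ^ 2 ^ (8 * (k + 18) + c1 + c2) <= n ->
  word_size D n <= c1 * l ->
  (forall (T : n.-tuple (Sigma n)) (X : representation m (Sigma n) n),
     is_repr_of T X -> size (memory D T X) <= c2 * repr_size X * l ^ k) ->
  exists (T : n.-tuple (Sigma n)) (X : representation m (Sigma n) n) (i : 'I_n),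
    is_repr_of T X /\
    l <= 4 * (k + 17) * q * probes (query D i) (memory D T X).
Proof.
move=> Sigma_gt1 D_ok l q; set Q := 8 * (k + 18) + c1 + c2 => le_n le_w le_mem.
have n_gt0 : 0 < n by apply: leq_trans le_n; rewrite expn_gt0.
have le_Ql : 2 ^ Q < l by rewrite ltnS trunc_log_max.
have lt_Q2 : 1 < 2 ^ Q by rewrite -{1}[1](expn0 2) ltn_exp2l // /Q; lia.
have [lt_q le_q] : 2 ^ q.-1 < l /\ l <= 2 ^ q.
  have l_gt1 : 1 < l by lia.
  by have /andP[] := up_log_bounds (isT : 1 < 2) l_gt1.
have lt_Qq : Q < q by rewrite -(ltn_exp2l (m := 2)) // (leq_trans le_Ql).
have le_qq : q * q <= 2 ^ q by apply: leq_sqr_exp2; rewrite /Q in lt_Qq; lia.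
have [k_le c1_le c2_le] : [/\ 8 * (k + 18) <= q, c1 <= q & c2 <= q].
  by rewrite /Q in lt_Qq; split; lia.
have q_gt0 : 0 < q by lia.
have e2q : 2 ^ q = 2 * 2 ^ q.-1 by rewrite -expnS prednK //; lia.
pose p := 2 ^ q.
have p_pow j : 2 ^ (j * q) = p ^ j by rewrite mulnC expnM.
have l_big : 4 * (k + 18) * q < l.
  have : 8 * (k + 18) * q <= q * q by rewrite leq_mul2r k_le orbT.
  by move: le_qq lt_q; rewrite e2q; clear; lia.
pose d := l.-1 %/ (16 * q); pose beta := 4 * q; pose rho := (k + 11) * q.
pose t := (beta * d).-1 %/ rho.+2.
have [bd_l /andP[t_gt0 t_le'] rho_le lt_d le_pr] :
  [/\ 4 * (beta * d) <= l.-1, 0 < t <= l, rho.+2 <= (k + 12) * q,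
      rho.+2 * t < beta * d & forall pr, t < pr -> l <= 4 * (k + 17) * q * pr].
  exact: butterfly_parameters.
have t_le : t <= p by exact: leq_trans le_q.
have q_le_p : q <= p by rewrite ltnW // ltn_expl.
have p_ge : 9 <= p.
  by apply: leq_trans q_le_p; apply: leq_trans k_le; clear; lia.
have [||||||T [X [i [repr_T lt_t]]]] := @many_probes m Sigma D n d beta rho t l
  (c2 * (2 + 2 ^ beta.*2 * ((2 ^ beta.*2) ^ d).*2 * d + (2 ^ beta.*2) ^ d + l.*2 + 1).+1
    * l ^ k) Sigma_gt1 D_ok.
- rewrite -!expnM -expnD; have := trunc_logP (isT : 1 < 2) n_gt0.
  apply: leq_trans; rewrite leq_exp2l // -[trunc_log 2 n]/(l.-1).
  by apply: leq_trans bd_l; clear; lia.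
- exact: trunc_log_ltn.
- move=> T X /le_mem le_X le_g; apply: leq_trans le_X _.
  by rewrite leq_mul // leq_mul.
- have eb : 2 ^ beta.*2 = p ^ 8 by rewrite -p_pow; congr (2 ^ _); rewrite /beta; lia.
  (* The powers of [p] in the space: 1 for [c2], 2 for the factors [d] and [l] of the chain size,
     [k] for the polylog, 8 for the degree. *)
  rewrite expnM eb /rho p_pow (_ : k + 11 = 1 + 2 + k + 8) ?expnD; last lia.
  have n_gt0' : 0 < (p ^ 8) ^ d by rewrite !expn_gt0.
  have b_gt0 : 0 < p ^ 8 by rewrite !expn_gt0.
  move: (p ^ 8) ((p ^ 8) ^ d) n_gt0' b_gt0 => b N N_gt0 b_gt0.
  have le_d : d <= p.
    apply: leq_trans le_q; apply: leq_trans (leq_pred l).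
    by apply: leq_trans bd_l; rewrite mulnA leq_pmull // !muln_gt0 q_gt0.
  have le_lk : l ^ k <= p ^ k by case: (k) => // k'; rewrite leq_exp2r.
  have le_g : (2 + b * N.*2 * d + N + l.*2 + 1).+1 <= p ^ 2 * (b * N).
    exact: chain_size_bound.
  have le_c2 : c2 <= p := leq_trans c2_le q_le_p.
  have := leq_mul (leq_mul le_c2 le_g) le_lk => /leq_trans; apply.
  rewrite expn1; have : p * (p ^ 2 * (b * N)) * p ^ k <= p * (p ^ 2 * (b * N)) * p ^ k * t.
    by rewrite leq_pmulr.
  by move=> /leq_trans; apply; apply: eq_leq; lia.
(* As the word size is at most [p^2], the left side is at most [8 * p^3 <= p^4]; hence
   [beta = 4 * q]. *)
- rewrite /beta p_pow; have le_rho : rho.+2 <= p.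
    apply: leq_trans rho_le _; apply: leq_trans le_qq.
    by rewrite leq_mul2r; apply/orP; right; apply: leq_trans k_le; clear; lia.
  have le_w' : word_size D n <= p * p.
    exact: leq_trans le_w (leq_mul (leq_trans c1_le q_le_p) le_q).
  apply: (@leq_trans (4 * ((p + p * p) * p))).
    by rewrite leq_mul2l /= leq_mul // leq_add.
  have le_pp : p + p * p <= 2 * (p * p) by rewrite mul2n -addnn leq_add2r leq_pmulr //; lia.
  apply: (@leq_trans (8 * (p * p * p))).
    by rewrite (_ : 8 = 4 * 2) // -mulnA leq_mul2l /= mulnA leq_mul2r le_pp orbT.
  by rewrite !expnS expn0 muln1 -!mulnA leq_mul2r; apply/orP; right; lia.
- exact: lt_d.
by exists T, X, i; split=> //; exact: le_pr.
Qed.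

(** * Passage to real logarithms *)

Import Order.TTheory GRing.Theory Num.Theory.

Local Open Scope ring_scope.

Lemma ln2_gt0 (R : realType) : 0 < ln (2 : R).
Proof. by rewrite ln_gt0 // ltr1n. Qed.

Lemma log2_exp2 (R : realType) (j : nat) : log2 (2 ^+ j : R) = j%:R.
Proof.
by rewrite /log2 lnXn ?ltr0n // -[X in X / _]mulr_natl mulfK // gt_eqF // ln2_gt0.
Qed.

Lemma ler_log2 (R : realType) (x y : R) : 0 < x -> x <= y -> log2 x <= log2 y.
Proof.
move=> x_gt0 le_xy; rewrite /log2 ler_pM2r ?invr_gt0 ?ln2_gt0 //.
by rewrite ler_ln ?posrE // (lt_le_trans x_gt0).
Qed.

Theorem theorem5p2 (R : realType) (m : dict_measure) (Sigma : nat -> finType)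
    (hSigma : forall n, (1 < #|Sigma n|)%N) (D : access_structure m Sigma)
    (hcorrect : solves_access D)
    (hword : log_word_size R D)
    (hspace : polylog_space R D) :
  exists (c : R) (N : nat), 0 < c /\
    forall n, (N <= n)%N ->
      exists (T : n.-tuple (Sigma n)) (X : representation m (Sigma n) n) (i : 'I_n),
        is_repr_of T X /\
        c * (log2 n%:R / log2 (log2 n%:R))
          <= (probes (query D i) (memory D T X))%:R.
Proof.
have [C1 [N1 le_w]] := hword; have [C2 [k [N2 le_mem]]] := hspace.
pose c1 := Num.bound `|C1|; pose c2 := Num.bound `|C2|.
have le_C1 : C1 <= c1%:R.
  by apply: le_trans (ler_norm _) _; apply/ltW/archi_boundP.
have le_C2 : C2 <= c2%:R.
  by apply: le_trans (ler_norm _) _; apply/ltW/archi_boundP.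
pose N0 := (2 ^ 2 ^ (8 * (k + 18) + c1 + c2))%N.
(* The 4 of the integer bound is doubled to pay for [q <= 2 * (q - 1)], as log log n is bounded
   below only by [q - 1]. *)
exists (8 * (k + 17))%N%:R^-1, (maxn N0 (maxn N1 N2)); split.
  by rewrite invr_gt0 ltr0n; lia.
move=> n; rewrite !geq_max => /and3P[n_N0 n_N1 n_N2].
have n_gt0 : (0 < n)%N by apply: leq_trans n_N0; rewrite expn_gt0.
set L := log2 n%:R; pose l := (trunc_log 2 n).+1; pose q := up_log 2 l.
have L_le : L <= l%:R.
  rewrite -log2_exp2; apply: ler_log2; first by rewrite ltr0n.
  by rewrite -natrX ler_nat ltnW // trunc_log_ltn.
have L_ge : l.-1%:R <= L.
  rewrite -log2_exp2; apply: ler_log2; first by rewrite exprn_gt0.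
  by rewrite -natrX ler_nat trunc_logP.
have L_ge0 : 0 <= L by apply: le_trans L_ge.
have [||T [X [i [repr_T le_l]]]] :=
  access_lower_bound_nat (c1 := c1) (c2 := c2) (hSigma n) hcorrect n_N0 (k := k).
- rewrite -(ler_nat R) (le_trans (le_w n n_N1)) // natrM.
  exact: le_trans (ler_wpM2r L_ge0 le_C1) (ler_wpM2l (ler0n _ _) L_le).
- move=> T X /(le_mem n n_N2) le_size; rewrite -(ler_nat R) (le_trans le_size) //.
  rewrite !natrM natrX; apply: le_trans (_ : c2%:R * (repr_size X)%:R * L ^+ k <= _).
    by rewrite ler_wpM2r ?exprn_ge0 // ler_wpM2r.
  by rewrite ler_wpM2l ?mulr_ge0 // lerXn2r ?nnegrE.
rewrite -/l -/q in le_l; exists T, X, i; split=> //.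
set pr := probes _ _ in le_l *.
have lt_l : (2 < l)%N.
  rewrite ltnS trunc_log_max //; apply: leq_trans n_N0; rewrite leq_exp2l //.
  by rewrite -{1}[2%N]expn1 leq_exp2l //; lia.
have /andP[lt_q le_q] : (2 ^ q.-1 < l <= 2 ^ q)%N 
  by apply: up_log_bounds => //; exact: ltnW.
have q_gt1 : (1 < q)%N by rewrite -(ltn_exp2l (m := 2)) // (leq_trans lt_l).
have LL_ge : q.-1%:R <= log2 L.
  rewrite -log2_exp2; apply: ler_log2; first by rewrite exprn_gt0.
  by apply: le_trans L_ge; rewrite -natrX ler_nat -ltnS prednK // (ltn_trans _ lt_l).
have LL_gt0 : 0 < log2 L by apply: lt_le_trans LL_ge; rewrite ltr0n; lia.
rewrite mulrC ler_pdivrMr ?ltr0n; last lia.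
rewrite ler_pdivrMr // (le_trans L_le) //.
apply: (@le_trans _ _ (pr%:R * (8 * (k + 17))%N%:R * q.-1%:R)); last first.
  by rewrite ler_wpM2l // mulr_ge0.
rewrite -!natrM ler_nat (leq_trans le_l) //.
have : (4 * (k + 17) * pr * q <= 4 * (k + 17) * pr * (2 * q.-1))%N.
  by rewrite leq_mul2l; apply/orP; right; lia.
by move: q.-1 => q'; clear; lia.
Qed.
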